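(* Let $d,n\in\mathbb{N}$, $r,T>0$, $\hat\alpha=(\alpha_1,\dots,\alpha_d)\in(0,1]^d$, $A,B\in\mathbb{R}^{d\times d}$, $E\in\mathbb{R}^{d\times n}$, $C=(c_{ij})\in\mathbb{R}^{n\times d}$, $D=(d_{ij})\in\mathbb{R}^{n\times n}$, and let $\tau_k:[0,T]\to\mathbb{R}_{\ge 0}$ ($k=1,2,3$) be continuous with $t-\tau_k(t)\ge -r$ for all $t\in[0,T]$. Suppose that $A$ is Metzler, that $B,E,C,D$ are nonnegative, and that $$\sum_{k=1}^d|c_{ik}|<1\quad\text{and}\quad \sum_{j=1}^n|d_{ij}|<1\qquad\text{for all } i=1,\dots,n.$$ Then the system $$\begin{cases}{}^{C}D^{\hat\alpha}_{0^+}x(t)=Ax(t)+Bx(t-\tau_1(t))+Ey(t-\tau_2(t))+f(t), & t\in(0,T],\\ y(t)=Cx(t)+Dy(t-\tau_3(t))+g(t), & t\in[0,T],\end{cases}$$ is positive.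
   Context: For $\alpha\in(0,1]$, $I^\alpha_{0^+}u(t)=\frac{1}{\Gamma(\alpha)}\int_0^t(t-s)^{\alpha-1}u(s)\,ds$ (with $I^0_{0^+}u=u$), and the Caputo fractional derivative is ${}^{C}D^{\alpha}_{0^+}u(t)=\frac{d}{dt}I^{1-\alpha}_{0^+}(u(t)-u(0))$ for $t>0$; ${}^{C}D^{\hat\alpha}_{0^+}x(t)=({}^{C}D^{\alpha_1}_{0^+}x_1(t),\dots,{}^{C}D^{\alpha_d}_{0^+}x_d(t))^{\rm T}$. A square matrix is Metzler if its off-diagonal entries are nonnegative; a matrix is nonnegative if all its entries are; $\succeq$ is the entrywise order. For continuous $f:[0,T]\to\mathbb{R}^d$, $g:[0,T]\to\mathbb{R}^n$, $\psi:[-r,0]\to\mathbb{R}^d$, $\varphi:[-r,0]\to\mathbb{R}^n$ satisfying the compatibility condition $C\psi(0)+D\varphi(-\tau_3(0))+g(0)=\varphi(0)$, $\Phi(\cdot;\psi,\varphi)=(x,y)^{\rm T}$ denotes the solution of the system with $x=\psi$, $y=\varphi$ on $[-r,0]$, i.e. the (under the stated row-sum conditions, unique) continuous function $[-r,T]\to\mathbb{R}^{d+n}$ satisfying the equations and the initial condition. The system is called positive if for all continuous $f,g\succeq 0$ on $[0,T]$ and all continuous $\psi,\varphi\succeq0$ on $[-r,0]$ satisfying the compatibility condition, $\Phi(t;\psi,\varphi)\succeq 0$ for all $t\in[0,T]$. *)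

(* Defs.v *)
From HB Require Import structures.
From mathcomp Require Import all_boot all_order all_algebra.
From mathcomp Require Import all_classical all_reals all_analysis.
Import Order.TTheory GRing.Theory Num.Theory.
Import numFieldNormedType.Exports.

Set Implicit Arguments.
Unset Strict Implicit.
Unset Printing Implicit Defensive.

Local Open Scope classical_set_scope.
Local Open Scope ring_scope.

Definition Gamma (R : realType) (a : R) : R :=
  \int[@lebesgue_measure R]_(s in `[0, +oo[) (s `^ (a - 1) * expR (- s)).

(* The integrand is singular at s = t when a < 1; the library sets
   0 `^ (a - 1) = 0 there, on a null set. *)
Definition frac_int (R : realType) (a : R) (u : R -> R) (t : R) : R :=
  if a == 0 then u t
  else (Gamma a)^-1 *
       \int[@lebesgue_measure R]_(s in `[0, t]) ((t - s) `^ (a - 1) * u s).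

(* Derivative of a function known only on D: two-sided at interior points of D,
   one-sided at an endpoint of an interval. *)
Definition has_derivative_within (R : realType) (D : set R) (F : R -> R)
    (t l : R) : Prop :=
  (fun s => (F s - F t) / (s - t)) @ within D t^' --> l.

(* The Caputo derivative of order a of u : [0, T] -> R exists at t and
   equals l. *)
Definition has_caputo (R : realType) (T a : R) (u : R -> R) (t l : R) : Prop :=
  has_derivative_within `[0, T] (frac_int (1 - a) (fun s => u s - u 0)) t l.

Definition metzler (R : realType) (d : nat) (A : 'M[R]_d) : Prop :=
  forall i j : 'I_d, i != j -> 0 <= A i j.

Definition nonneg_mx (R : realType) (m n : nat) (M : 'M[R]_(m, n)) : Prop :=
  M \is a mxOver Num.nneg.

Definition is_delay (R : realType) (r T : R) (tau : R -> R) : Prop :=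
  {within `[0, T], continuous tau} /\
  (forall t : R, t \in `[0, T] -> 0 <= tau t /\ - r <= t - tau t).

Definition compatible (R : realType) (d n : nat)
    (C : 'M[R]_(n, d)) (D : 'M[R]_n) (tau3 : R -> R) (g : R -> 'cV[R]_n)
    (psi : R -> 'cV[R]_d) (phi : R -> 'cV[R]_n) : Prop :=
  C *m psi 0 + D *m phi (- tau3 0) + g 0 = phi 0.

(* Functions on [0, T], [-r, 0] and [-r, T] are represented by total functions
   whose values outside the interval are irrelevant. *)
Definition is_solution (R : realType) (d n : nat) (r T : R)
    (alpha : 'I_d -> R) (A B : 'M[R]_d) (E : 'M[R]_(d, n))
    (C : 'M[R]_(n, d)) (D : 'M[R]_n) (tau1 tau2 tau3 : R -> R)
    (f : R -> 'cV[R]_d) (g : R -> 'cV[R]_n)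
    (psi : R -> 'cV[R]_d) (phi : R -> 'cV[R]_n)
    (x : R -> 'cV[R]_d) (y : R -> 'cV[R]_n) : Prop :=
  [/\ {within `[- r, T], continuous x},
      {within `[- r, T], continuous y},
      (forall t : R, t \in `[- r, 0] -> x t = psi t /\ y t = phi t),
      (forall t : R, t \in `]0, T] -> forall i : 'I_d,
        has_caputo T (alpha i) (fun s => x s i 0) t
          ((A *m x t + B *m x (t - tau1 t) + E *m y (t - tau2 t) + f t) i 0)) &
      (forall t : R, t \in `[0, T] ->
        y t = C *m x t + D *m y (t - tau3 t) + g t)].

Definition positive_system (R : realType) (d n : nat) (r T : R)
    (alpha : 'I_d -> R) (A B : 'M[R]_d) (E : 'M[R]_(d, n))
    (C : 'M[R]_(n, d)) (D : 'M[R]_n) (tau1 tau2 tau3 : R -> R) : Prop :=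
  forall (f : R -> 'cV[R]_d) (g : R -> 'cV[R]_n)
         (psi : R -> 'cV[R]_d) (phi : R -> 'cV[R]_n),
    {within `[0, T], continuous f} -> {within `[0, T], continuous g} ->
    {within `[- r, 0], continuous psi} -> {within `[- r, 0], continuous phi} ->
    (forall t : R, t \in `[0, T] -> nonneg_mx (f t) /\ nonneg_mx (g t)) ->
    (forall t : R, t \in `[- r, 0] -> nonneg_mx (psi t) /\ nonneg_mx (phi t)) ->
    compatible C D tau3 g psi phi ->
  forall (x : R -> 'cV[R]_d) (y : R -> 'cV[R]_n),
    is_solution r T alpha A B E C D tau1 tau2 tau3 f g psi phi x y ->
  forall t : R, t \in `[0, T] -> nonneg_mx (x t) /\ nonneg_mx (y t).

(* Main.v *)
Require Import Defs.
From HB Require Import structures.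
From mathcomp Require Import all_boot all_order all_algebra.
From mathcomp Require Import all_classical all_reals all_analysis.
From mathcomp Require Import measurable_realfun ring lra.
Import Order.TTheory GRing.Theory Num.Theory.
Import numFieldNormedType.Exports.
Local Open Scope classical_set_scope.
Local Open Scope ring_scope.

Set Implicit Arguments.
Unset Strict Implicit.
Unset Printing Implicit Defensive.

(** Positivity is carried forward in time by steps of one fixed length del.

    Suppose that x is nonnegative up to time a, and minimise
    x_i(s) / (1 + (s - a) / del) over all components i and all s in
    [a, a + del].  If the minimum is -m < 0, reached by x_i at tau, put
    mu = m (1 + (tau - a) / del): then x_i(tau) = - mu and every x_k is at least
    - mu up to time tau.  Because the rows of D sum to less than 1, the
    algebraic equation turns this into y >= - row_gain D * mu
    (algebraic_lower_bound).  Since A is Metzler and B, E, f are nonnegative,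
    the i-th right-hand side at tau is therefore at least - K mu, with K
    depending on A, B, D and E only.  On the other hand x_i is nonnegative until
    a and falls to its minimum - mu within the short time tau - a <= del, which
    forces its Caputo derivative at tau to be at most
    - mu (tau - a)^(-alpha) / Gamma (1 - alpha) when alpha < 1, and at most
    - m / del when alpha = 1.  For small del this is below - K mu
    (caputo_at_minimum), a contradiction (positivity_step).  As del does not
    depend on a, finitely many steps reach T.  The weight 1 + (s - a) / del
    serves alpha = 1 only: there the derivative at an unweighted minimum could
    be 0.

    The analytic core is the bound on the Caputo derivative at a minimum
    (frac_conv_left_slope_at_minimum).  That derivative exists only as the
    derivative of the fractional integral of a merely continuous function, so
    one cannot rewrite it as an integral of increments of u.  With
    b = 1 - alpha, let w be u, raised by mu after time a; then w >= 0,
    w(tau) = 0, and raising by mu contributes the term mu (tau - a)^(b - 1).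
    What remains is that the convolution G of w with z^(b - 1) cannot satisfy
    G(tau) - G(tau - h) >= c h for all small h > 0 with c > 0
    (frac_conv_no_linear_drop).  Integrate this inequality against the weight
    h^(- b - 1) over h in [eta, del].  The kernel
    h^(- b - 1) (z - h)^(b - 1) has the elementary primitive
    - (z / h - 1)^b / (b z), so by Tonelli's theorem the left-hand side is at
    most the integral of w(s) against a function of tau - s of the form
    eta^-1 rho ((tau - s) / eta) with rho integrable (weighted_kernel_le,
    weighted_conv_le).  Such a family concentrates at tau, where w vanishes, so
    the bound tends to 0 with eta, whereas the right-hand side tends to
    c del^(1 - b) / (1 - b) > 0. *)

(** * The fundamental theorem of calculus with singular endpoints *)

(** For a nonnegative integrand, integrability up to endpoints where it may blow
    up comes for free: exhaust the interval by compact ones and let monotone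
    convergence do the rest. *)
Lemma ge0_integral_oo_FTC2 (R : realType) (f F : R -> R) (a b : R) :
  a < b ->
  {in `]a, b[, forall x, 0 <= f x} ->
  {in `]a, b[, continuous f} ->
  (forall x : R, x \in `]a, b[ -> is_derive x 1 F (f x)) ->
  F x @[x --> a^'+] --> F a -> F x @[x --> b^'-] --> F b ->
  (\int[@lebesgue_measure R]_(x in `]a, b[) (f x)%:E = (F b - F a)%:E)%E.
Proof.
move=> ab f0 cf dF Fa Fb.
pose e (n : nat) : R := (b - a) / 2 * n.+2%:R^-1.
have e_gt0 n : 0 < e n by rewrite mulr_gt0 ?divr_gt0 ?subr_gt0 ?invr_gt0.
have e_lt n : e n < (b - a) / 2.
  by rewrite gtr_pMr ?divr_gt0 ?subr_gt0// invf_lt1// ltr1n.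
have cvge : e n @[n --> \oo] --> 0.
  rewrite -[X in _ --> X](mulr0 ((b - a) / 2)); apply: cvgMr.
  by have := @cvg_harmonic R; rewrite -(@cvg_shiftS R (@harmonic R)).
pose A (n : nat) : set R := `[a + e n, b - e n]%classic.
have Aoo n x : A n x -> x \in `]a, b[.
  rewrite /A /= !in_itv/= => /andP[h1 h2].
  by rewrite (lt_le_trans _ h1) ?ltrDl// (le_lt_trans h2)// ltrBlDr ltrDl.
have UA : \bigcup_n A n = `]a, b[%classic.
  apply/seteqP; split => [x [n _ /Aoo//]|x/=]; rewrite in_itv/= => /andP[ax xb].
  have m0 : 0 < Num.min (x - a) (b - x) by rewrite lt_min !subr_gt0 ax.
  have /cvgrPdist_lt/(_ _ m0)[n _ /(_ n (leqnn n))/=] := cvge.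
  rewrite sub0r normrN gtr0_norm// lt_min => /andP[h1 h2]; exists n => //=.
  by rewrite /A/= in_itv/=; apply/andP; split; lra.
have mfo : measurable_fun (`]a, b[%classic : set R) (fun x : R => (f x)%:E).
  apply/measurable_EFinP; apply: open_continuous_measurable_fun => //.
  by move=> x; rewrite inE; exact: cf.
have hA : {homo A : n m / (n <= m)%N >-> (n <= m)%O}.
  move=> n m nm; rewrite subsetEset => x; rewrite /A /= !in_itv/= => /andP[h1 h2].
  have : e m <= e n by rewrite ler_pM2l ?divr_gt0 ?subr_gt0// lef_pV2 ?posrE// ler_nat !ltnS.
  by move=> h; apply/andP; split; lra.
have cvgI : (\int[@lebesgue_measure R]_(x in A n) (f x)%:E @[n --> \oo] -->
    \int[@lebesgue_measure R]_(x in \bigcup_n A n) (f x)%:E)%E.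
  apply: ge0_nondecreasing_set_cvg_integral => //.
  - by move=> n; exact: measurable_itv.
  - move=> n; apply: measurable_funS mfo => //.
    by move=> x /Aoo.
  - by move=> n x /Aoo/f0; rewrite lee_fin.
have IA n : (\int[@lebesgue_measure R]_(x in A n) (f x)%:E = (F (b - e n) - F (a + e n))%:E)%E.
  have lt : a + e n < b - e n by have := e_lt n; lra.
  rewrite EFinB; apply: continuous_FTC2 => //.
  - apply/continuous_in_subspaceT => x; rewrite inE => /Aoo; exact: cf.
  - have dx x : x \in `[a + e n, b - e n] -> derivable F x 1.
      by move=> xA; have [] := dF x (Aoo n x xA).
    have cF x : x \in `[a + e n, b - e n] -> {for x, continuous F}.
      by move=> /dx/derivable1_diffP/differentiable_continuous.
    split.
    + by move=> x xA; apply: dx; apply: subset_itv_oo_cc xA.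
    + by apply/cvg_at_right_filter/cF; rewrite in_itv/= lexx ltW.
    + by apply/cvg_at_left_filter/cF; rewrite in_itv/= lexx ltW.
  - move=> x xA; rewrite derive1E; apply: derive_val; apply: dF.
    by apply: (Aoo n); apply: subset_itv_oo_cc xA.
have cvgF : (F (b - e n) - F (a + e n)) @[n --> \oo] --> F b - F a.
  apply: cvgB.
  - move/cvg_at_leftP : Fb; apply; split => [n|]; first by rewrite ltrBlDr ltrDl.
    by rewrite -[X in _ --> X]subr0; apply: cvgB => //; exact: cvg_cst.
  - move/cvg_at_rightP : Fa; apply; split => [n|]; first by rewrite ltrDl.
    by rewrite -[X in _ --> X]addr0; apply: cvgD => //; exact: cvg_cst.
move: cvgI; rewrite UA (funext IA) => cvgI; apply: (cvg_unique _ cvgI) => //.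
by apply: cvg_EFin => //; exact: nearW.
Qed.

(** * Integrals of powers *)

Lemma powR_continuous (R : realType) (p x : R) : 0 < x ->
  {for x, continuous (fun y : R => y `^ p)}.
Proof.
move=> x0; apply/differentiable_continuous/derivable1_diffP.
by have [] := is_derive1_powR p x0.
Qed.

Lemma powR_cvg_at_right (R : realType) (p a : R) : 0 <= a -> (0 < p) || (0 < a) ->
  (fun x : R => x `^ p) x @[x --> a^'+] --> a `^ p.
Proof.
rewrite le_eqVlt => /predU1P[<-|a0 _]; last exact/cvg_at_right_filter/powR_continuous.
by rewrite ltxx orbF => p0; rewrite powR0 ?gt_eqF//; exact: powR_cvg0.
Qed.

Lemma measurable_subl_powR (R : realType) (c p : R) (D : set R) :
  measurable_fun D (fun s : R => (c - s) `^ p).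
Proof.
apply: measurable_funTS; apply: (measurableT_comp (measurable_powR _)).
exact: measurable_funB.
Qed.

Lemma integral_subl_powR (R : realType) (p a b c : R) : a < b -> b <= c ->
  p != 0 -> (0 < p) || (b < c) ->
  (\int[@lebesgue_measure R]_(s in `[a, b]) ((c - s) `^ (p - 1))%:E =
   (((c - a) `^ p - (c - b) `^ p) / p)%:E)%E.
Proof.
move=> ab bc p0 pbc.
rewrite integral_itv_bndoo; last first.
  by apply/measurable_EFinP; exact: measurable_subl_powR.
pose F (s : R) := - p^-1 * (c - s) `^ p.
rewrite (_ : _ / p = F b - F a); last by rewrite /F; field.
have subl_pos s : s \in `]a, b[ -> 0 < c - s.
  by rewrite in_itv/= => /andP[_ sb]; rewrite subr_gt0 (lt_le_trans sb).
have dF (s : R) : s < c -> is_derive s 1 F ((c - s) `^ (p - 1)).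
  rewrite -subr_gt0 => sc.
  have h : is_derive s 1 (fun s => c - s) (-1 : R).
    have k := is_deriveB (is_derive_cst c s (1 : R)) (is_derive_id s 1).
    apply: (is_derive_eq k). by rewrite sub0r.
  have k := @is_derive1_comp R (fun x : R => x `^ p) (fun x => c - x) s _ _ (is_derive1_powR p sc) h.
  by apply: (is_derive_eq (is_deriveZ (- p^-1) k)); rewrite /GRing.scale/=; field.
have cF s : s < c -> {for s, continuous F}.
  by move=> /dF[+ _] => /derivable1_diffP/differentiable_continuous.
apply: ge0_integral_oo_FTC2 => //.
- by move=> s _; exact: powR_ge0.
- move=> s /subl_pos sc.
  apply: (@continuous_comp _ _ _ (fun s => c - s) (fun x : R => x `^ (p - 1))).
    by apply: continuousB => //; exact: cst_continuous.
  exact: powR_continuous.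
- by move=> s /subl_pos; rewrite subr_gt0; exact: dF.
- by apply/cvg_at_right_filter/cF; exact: lt_le_trans bc.
- move: bc; rewrite le_eqVlt => /predU1P[bc|bc]; last exact/cvg_at_left_filter/cF.
  apply: cvgMr; subst c.
  move: pbc; rewrite ltxx orbF => p_gt0.
  apply/cvg_at_leftP => u [ub cu].
  have h0 : (0 < p) || (0 < (0 : R)) by rewrite p_gt0.
  have /cvg_at_rightP h := powR_cvg_at_right (lexx (0 : R)) h0.
  rewrite subrr; apply: h; split=> [n|]; first by rewrite subr_gt0.
  by rewrite -(subrr b); apply: cvgB => //; exact: cvg_cst.
Qed.

Lemma integral_powR (R : realType) (p a b : R) : 0 <= a -> a < b ->
  p != 0 -> (0 < p) || (0 < a) ->
  (\int[@lebesgue_measure R]_(s in `[a, b]) (s `^ (p - 1))%:E =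
   ((b `^ p - a `^ p) / p)%:E)%E.
Proof.
move=> a0 ab p0 pa.
rewrite integral_itv_bndoo; last first.
  by apply/measurable_EFinP/measurable_funTS; exact: measurable_powR.
pose F (s : R) := p^-1 * s `^ p.
rewrite (_ : _ / p = F b - F a); last by rewrite /F; field.
have pos s : s \in `]a, b[ -> 0 < s.
  by rewrite in_itv/= => /andP[sa _]; rewrite (le_lt_trans a0).
have dF (s : R) : 0 < s -> is_derive s 1 F (s `^ (p - 1)).
  move=> s0; have h := is_derive1_powR p s0.
  by apply: (is_derive_eq (is_deriveZ p^-1 h)); rewrite /GRing.scale/=; field.
apply: ge0_integral_oo_FTC2 => //.
- by move=> s _; exact: powR_ge0.
- by move=> s /pos; exact: powR_continuous.
- by move=> s /pos; exact: dF.
- by apply: cvgMr; exact: powR_cvg_at_right.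
- apply/cvg_at_left_filter/differentiable_continuous/derivable1_diffP.
  by have [] := dF b (le_lt_trans a0 ab).
Qed.

(** * The weighted kernel inequality *)

(** The kernel of the fractional integral extended by 0 to negative arguments,
    so that convolutions over [0, tau - h] become integrals over a domain that
    is independent of h, as Tonelli's theorem wants. *)
Definition cut_powR (R : realType) (b z : R) : R :=
  ((fun x : R => x `^ (b - 1)) \_ `[0, +oo[) z.

(** This is eta^-1 rho (z / eta) for rho x = min (x^(b - 1), x^(b - 2)) / b, an
    approximate identity up to a constant factor as eta tends to 0. *)
Definition residual (R : realType) (b eta z : R) : R :=
  Num.min ((b * eta `^ b)^-1 * z `^ (b - 1)) (eta `^ (1 - b) / b * z `^ (b - 1 - 1)).

Lemma residual_ge0 (R : realType) (b eta z : R) : 0 < b -> 0 <= residual b eta z.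
Proof.
move=> b0; rewrite le_min !mulr_ge0 ?powR_ge0 ?invr_ge0 ?mulr_ge0 ?powR_ge0 ?(ltW b0)//.
Qed.

Lemma cut_powR_ge0 (R : realType) (b z : R) : 0 <= cut_powR b z.
Proof. by rewrite /cut_powR patchE; case: ifP => // _; exact: powR_ge0. Qed.

Lemma cut_powRE (R : realType) (b z : R) : 0 <= z -> cut_powR b z = z `^ (b - 1).
Proof. by move=> z0; rewrite /cut_powR patchE mem_set//= in_itv/= z0. Qed.

Lemma measurable_cut_powR (R : realType) (b : R) : measurable_fun [set: R] (cut_powR b).
Proof.
apply: ((measurable_restrictT (fun x : R => x `^ (b - 1)) (measurable_itv `[0, +oo[)).1 _).
by apply: measurable_funTS; exact: measurable_powR.
Qed.

Lemma is_derive_weighted_kernel (R : realType) (b z h : R) : 0 < b -> 0 < h -> h < z ->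
  is_derive h 1 (fun h => - (b * z)^-1 * (z / h - 1) `^ b)
    (h `^ (- b - 1) * (z - h) `^ (b - 1)).
Proof.
move=> b0 h0 hz.
have z0 : 0 < z := lt_trans h0 hz.
have zh : 0 < z / h - 1 by rewrite subr_gt0 ltr_pdivlMr// mul1r.
have hn : h != 0 by rewrite gt_eqF.
have k1 : is_derive h 1 (fun h => z / h - 1) (- z * h^-2).
  have dV : is_derive h 1 (fun y : R => y^-1) (- h ^- 2 *: (1 : R)).
    exact: (@is_deriveV R id h 1 1 hn (is_derive_id h (1 : R))).
  have k := is_deriveB (is_deriveZ z dV) (is_derive_cst (1:R) h (1:R)).
  by apply: (is_derive_eq k); rewrite /GRing.scale/= -exprVn; field.
have k := @is_derive1_comp R (fun x : R => x `^ b) (fun h => z / h - 1) h _ _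
  (is_derive1_powR b zh) k1.
apply: (is_derive_eq (is_deriveZ (- (b * z)^-1) k)).
have -> : z / h - 1 = (z - h) / h by field.
rewrite powRM ?invr_ge0 ?subr_ge0 1?ltW//.
rewrite /GRing.scale/=.
have -> : h^-1 `^ (b - 1) = h `^ (- b - 1) * h ^+ 2.
  rewrite -powR_inv1 1?ltW// -powRrM mulN1r opprB -[h ^+ 2]powR_mulrn 1?ltW//.
  rewrite -powRD ?hn ?implybT//; congr (_ `^ _); ring.
by field; rewrite hn !gt_eqF.
Qed.

Lemma measurable_weighted_cut_powR (R : realType) (b p z : R) (D : set R) :
  measurable_fun D (fun h : R => h `^ p * cut_powR b (z - h)).
Proof.
apply: measurable_funTS; apply: measurable_funM; first exact: measurable_powR.
by apply: (measurableT_comp (measurable_cut_powR b)); exact: measurable_funB.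
Qed.

(** The left-hand side is the integral of h^(- b - 1) z^(b - 1) over [eta, del],
    so the lemma compares the kernel at z with its translates by h.  With
    P h = z^(b - 1) / (b h^b) and the primitive Q h = (z / h - 1)^b / (b z),
    the left-hand side is P eta - P del, the integral for z > eta is
    Q eta - Q (min z del), and Q <= P.  What is lost near h = 0 is P eta - Q eta,
    which the residual dominates as (1 - eta / z)^b >= 1 - eta / z. *)
Lemma weighted_kernel_le (R : realType) (b eta del z : R) :
  0 < b -> b < 1 -> 0 < eta -> eta < del -> 0 <= z ->
  (((eta `^ (- b) - del `^ (- b)) / b * z `^ (b - 1))%:E <=
   \int[@lebesgue_measure R]_(h in `[eta, del])
      (h `^ (- b - 1) * cut_powR b (z - h))%:E + (residual b eta z)%:E)%E.
Proof.
move=> b0 b1 eta0 etadel; rewrite le_eqVlt => /predU1P[<-|z0].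
  rewrite [_ `^ (b - 1)]powR0 ?subr_eq0 ?lt_eqF// mulr0.
  rewrite adde_ge0//; first by apply: integral_ge0 => h _; rewrite lee_fin mulr_ge0 ?powR_ge0 ?cut_powR_ge0.
  by rewrite lee_fin residual_ge0.
have del0 : 0 < del := lt_trans eta0 etadel.
have I0 : (0 <= \int[@lebesgue_measure R]_(h in `[eta, del])
      (h `^ (- b - 1) * cut_powR b (z - h))%:E)%E.
  by apply: integral_ge0 => h _; rewrite lee_fin mulr_ge0 ?powR_ge0 ?cut_powR_ge0.
pose P h := (z / h) `^ b / (b * z).
have PE h : 0 < h -> h `^ (- b) / b * z `^ (b - 1) = P h.
  move=> h0; rewrite /P powRM ?invr_ge0 1?ltW// -[h^-1]powR_inv1 1?ltW// -powRrM mulN1r.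
  rewrite powRB ?(gt_eqF z0) ?implybT// powRr1; last exact: ltW.
  field.
  by rewrite !gt_eqF.
have P0 h : 0 <= P h by rewrite /P divr_ge0 ?powR_ge0// mulr_ge0// ltW.
rewrite !mulrBl !PE//.
have residualE : residual b eta z = P eta * Num.min 1 (eta / z).
  have b_neq0 : b != 0 by rewrite gt_eqF.
  have eb_neq0 : eta `^ b != 0 by rewrite gt_eqF ?powR_gt0.
  rewrite minr_pMr// mulr1 -PE// powRN /residual; congr Num.min; first by field; rewrite b_neq0.
  rewrite [eta `^ (1 - b)]powRB ?(gt_eqF eta0) ?implybT// powRr1 ?(ltW eta0)//.
  rewrite [z `^ (b - 1 - 1)]powRB ?(gt_eqF z0) ?implybT// [z `^ 1]powRr1 ?(ltW z0)//.
  by field; rewrite b_neq0 eb_neq0 gt_eqF.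
have [zeta|etaz] := leP z eta.
  rewrite residualE min_l ?ler_pdivlMr ?mul1r// mulr1.
  by apply: le_trans (leeDr _ I0); rewrite lee_fin gerBl.
rewrite residualE min_r; last by rewrite ler_pdivrMr// mul1r ltW.
pose Q h := (z / h - 1) `^ b / (b * z).
have PQ : P eta - P eta * (eta / z) <= Q eta.
  rewrite /P /Q -[X in X - _]mulr1 -mulrBr mulrAC ler_wpM2r//.
    by rewrite invr_ge0 mulr_ge0 ?(ltW b0) ?(ltW z0).
  have -> : z / eta - 1 = z / eta * (1 - eta / z) by field; rewrite !gt_eqF.
  have x1 : 0 < 1 - eta / z <= 1.
    by rewrite subr_gt0 ltr_pdivrMr// mul1r etaz gerBl divr_ge0 ?ltW.
  case/andP: (x1) => x1a x1b.
  rewrite [X in _ <= X]powRM ?(ltW x1a) ?divr_ge0 ?(ltW eta0) ?(ltW z0)//.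
  by rewrite ler_wpM2l ?powR_ge0// ger1_powR// ltW.
suff QP : ((Q eta - P del)%:E <= \int[@lebesgue_measure R]_(h in `[eta, del])
      (h `^ (- b - 1) * cut_powR b (z - h))%:E)%E.
  by apply: le_trans (leeD2r _ QP); rewrite -EFinD lee_fin; move: PQ; lra.
(* The point where Q c = P del, that is z / c - 1 = z / del.  It lies below both
   z and del, so the singularity of the kernel at h = z is never reached. *)
pose c := z * del / (z + del).
have zd0 : 0 < z + del by rewrite addr_gt0.
have c0 : 0 < c by rewrite divr_gt0 ?mulr_gt0.
have zc : z / c - 1 = z / del by rewrite /c; field; rewrite !gt_eqF.
have cz : c < z by rewrite /c ltr_pdivrMr// ltr_pM2l// ltrDr.
have cdel : c <= del by rewrite /c ler_pdivrMr// mulrC ler_pM2l// lerDl ltW.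
have [ceta|etac] := leP c eta.
  apply: le_trans I0; rewrite lee_fin subr_le0 /Q /P ler_pM2r ?invr_gt0 ?mulr_gt0//.
  rewrite -zc; apply: ge0_ler_powR; rewrite ?nnegrE.
  - exact: ltW.
  - by rewrite ltW// subr_gt0 ltr_pdivlMr// mul1r.
  - by rewrite ltW// subr_gt0 ltr_pdivlMr// mul1r.
  - by rewrite lerD2r ler_pM2l// lef_pV2.
have -> : P del = Q c by rewrite /P /Q zc.
have sub : `[eta, c] `<=` `[eta, del] by apply: subset_itvl.
apply: (@le_trans _ _ (\int[@lebesgue_measure R]_(h in `[eta, c])
      (h `^ (- b - 1) * cut_powR b (z - h))%:E)%E); last first.
  apply: ge0_subset_integral => //.
  - by apply/measurable_EFinP; exact: measurable_weighted_cut_powR.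
  - by move=> h _; rewrite lee_fin mulr_ge0 ?powR_ge0 ?cut_powR_ge0.
rewrite integral_itv_bndoo; last by apply/measurable_EFinP; exact: measurable_weighted_cut_powR.
pose F h := - (b * z)^-1 * (z / h - 1) `^ b.
have -> : Q eta - Q c = F c - F eta by rewrite /F /Q; field; rewrite !gt_eqF.
have dF h : 0 < h -> h < z -> is_derive h 1 F (h `^ (- b - 1) * (z - h) `^ (b - 1)).
  by move=> h0 hz; exact: is_derive_weighted_kernel.
have cF h : 0 < h -> h < z -> {for h, continuous F}.
  by move=> h0 hz; have [+ _] := dF h h0 hz => /derivable1_diffP/differentiable_continuous.
have oo h : h \in `]eta, c[ -> 0 < h /\ h < z.
  by rewrite in_itv/= => /andP[h1 h2]; rewrite (lt_trans eta0)// (lt_trans h2).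
rewrite le_eqVlt; apply/orP; left; apply/eqP/esym.
transitivity (\int[@lebesgue_measure R]_(h in `]eta, c[)
      (h `^ (- b - 1) * (z - h) `^ (b - 1))%:E)%E.
  by apply: eq_integral => h; rewrite inE/= => /oo[h0 hz]; rewrite cut_powRE// subr_ge0 ltW.
apply: ge0_integral_oo_FTC2 => //.
- by move=> h _; rewrite mulr_ge0 ?powR_ge0.
- move=> h /oo[h0 hz]; apply: cvgM; first exact: powR_continuous.
  apply: (@continuous_comp _ _ _ (fun s => z - s) (fun x : R => x `^ (b - 1))).
    by apply: continuousB => //; exact: cst_continuous.
  by apply: powR_continuous; rewrite subr_gt0.
- by move=> h /oo[]; exact: dF.
- by apply/cvg_at_right_filter/cF.
- by apply/cvg_at_left_filter/cF.
Qed.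

(** * Integrals against the residual kernel *)

Lemma measurable_residual_subl (R : realType) (b eta c : R) (D : set R) :
  measurable_fun D (fun s : R => residual b eta (c - s)).
Proof.
rewrite (_ : (fun s => _) = (fun s => (b * eta `^ b)^-1 * (c - s) `^ (b - 1)) \min
  (fun s => eta `^ (1 - b) / b * (c - s) `^ (b - 1 - 1)))//.
by apply: measurable_minr; apply: measurable_funM => //; exact: measurable_subl_powR.
Qed.

Lemma integralZ_subl_powR (R : realType) (k p a b c : R) : 0 <= k -> a < b -> b <= c ->
  p != 0 -> (0 < p) || (b < c) ->
  (\int[@lebesgue_measure R]_(s in `[a, b]) (k * (c - s) `^ (p - 1))%:E =
   (k * (((c - a) `^ p - (c - b) `^ p) / p))%:E)%E.
Proof.
move=> k0 ab bc p0 pbc.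
under eq_integral do rewrite EFinM.
rewrite ge0_integralZl_EFin//; first by rewrite integral_subl_powR.
- by move=> s _; rewrite lee_fin powR_ge0.
- by apply/measurable_EFinP; exact: measurable_subl_powR.
Qed.

(** The bound is independent of eta because residual b eta is a rescaling of a
    fixed function; its first term comes from z <= eta, the second from z > eta. *)
Lemma integral_residual_le (R : realType) (b eta tau : R) :
  0 < b -> b < 1 -> 0 < eta -> eta < tau ->
  (\int[@lebesgue_measure R]_(s in `[0%R, tau]) (residual b eta (tau - s))%:E <=
   (b^-1 ^+ 2 + (b * (1 - b))^-1)%:E)%E.
Proof.
move=> b0 b1 eta0 etatau.
have tau0 := lt_trans eta0 etatau.
have b_neq0 : b != 0 by rewrite gt_eqF.
have eb_gt0 : 0 < eta `^ b by rewrite powR_gt0.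
have te : tau - eta < tau by rewrite ltrBlDr ltrDl.
have mres D : measurable_fun D (fun s : R => (residual b eta (tau - s))%:E).
  by apply/measurable_EFinP; exact: measurable_residual_subl.
have mpow k p D : measurable_fun D (fun s : R => (k * (tau - s) `^ p)%:E).
  by apply/measurable_EFinP; apply: measurable_funM => //; exact: measurable_subl_powR.
have splitU : `[0, tau]%classic = `[0, tau - eta]%classic `|` `]tau - eta, tau]%classic :> set R.
  by rewrite -itv_bndbnd_setU// bnd_simp ?subr_ge0 ltW.
rewrite splitU ge0_integral_setU//; last 2 first.
- by move=> s _; rewrite lee_fin residual_ge0.
- apply/disj_setPS => s []/=; rewrite !in_itv/= => /andP[_ h1] /andP[h2 _].
  by move: (lt_le_trans h2 h1); rewrite ltxx.
rewrite (addrC (b^-1 ^+ 2)) EFinD; apply: leeD.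
- apply: (@le_trans _ _ (\int[@lebesgue_measure R]_(s in `[0%R, (tau - eta)%R])
      ((eta `^ (1 - b) / b) * (tau - s) `^ (b - 1 - 1))%:E)%E).
    apply: ge0_le_integral => //; [|exact: mres|exact: mpow|].
    - by move=> s _; rewrite lee_fin residual_ge0.
    - by move=> s _; rewrite lee_fin ge_min lexx orbT.
  rewrite integralZ_subl_powR ?subr_gt0//; last 4 first.
  + by rewrite divr_ge0 ?powR_ge0 ?ltW.
  + exact: ltW.
  + by rewrite subr_eq0 lt_eqF.
  + by rewrite te orbT.
  rewrite lee_fin subKr subr0.
  have -> : b - 1 = - (1 - b) by ring.
  have e1 : 0 < eta `^ (1 - b) by rewrite powR_gt0.
  have t1 : 0 <= tau `^ (- (1 - b)) by rewrite powR_ge0.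
  have b1n : 1 - b != 0 by rewrite subr_eq0 gt_eqF.
  have -> : eta `^ (1 - b) / b * ((tau `^ (- (1 - b)) - eta `^ (- (1 - b))) / - (1 - b)) =
     (b * (1 - b))^-1 - eta `^ (1 - b) * tau `^ (- (1 - b)) / (b * (1 - b)).
    by rewrite [eta `^ (- _)]powRN; field; rewrite b_neq0 b1n gt_eqF.
  by rewrite gerBl divr_ge0 ?mulr_ge0 ?subr_ge0 ?(ltW b0) ?(ltW b1) ?(ltW e1).
- rewrite integral_itv_obnd_cbnd//.
  apply: (@le_trans _ _ (\int[@lebesgue_measure R]_(s in `[(tau - eta)%R, tau])
      ((b * eta `^ b)^-1 * (tau - s) `^ (b - 1))%:E)%E).
    apply: ge0_le_integral => //; [|exact: mres|exact: mpow|].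
    - by move=> s _; rewrite lee_fin residual_ge0.
    - by move=> s _; rewrite lee_fin ge_min lexx.
  rewrite integralZ_subl_powR ?subr_gt0 ?b0//; last first.
  + by rewrite invr_ge0 mulr_ge0 ?powR_ge0 ?(ltW b0).
  rewrite lee_fin subKr subrr powR0// subr0.
  by rewrite le_eqVlt; apply/orP; left; apply/eqP; field; rewrite b_neq0 gt_eqF.
- exact: mres.
Qed.

(** Near tau the factor w is small and the total mass of the residual is bounded;
    away from tau the residual is at most of order eta^(1 - b). *)
Lemma integral_mul_residual_le (R : realType) (b eta tau rho M eps : R) (w : R -> R) :
  0 < b -> b < 1 -> 0 < eta -> eta < tau -> 0 < rho -> 0 <= eps ->
  measurable_fun `[0, tau] w ->
  (forall s, s \in `[0, tau] -> 0 <= w s <= M) ->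
  (forall s, s \in `[0, tau] -> tau - s < rho -> w s <= eps) ->
  (\int[@lebesgue_measure R]_(s in `[0%R, tau]) (w s * residual b eta (tau - s))%:E <=
   (eps * (b^-1 ^+ 2 + (b * (1 - b))^-1) +
    tau * (M * (eta `^ (1 - b) / b * rho `^ (b - 1 - 1))))%:E)%E.
Proof.
move=> b0 b1 eta0 etatau rho0 eps0 mw wM weps.
have tau0 := lt_trans eta0 etatau.
set K := M * _.
have M0 : 0 <= M.
  have /wM/andP[] : (0 : R) \in `[0, tau] by rewrite in_itv/= lexx ltW.
  exact: le_trans.
have K0 : 0 <= K by rewrite !mulr_ge0 ?powR_ge0 ?invr_ge0 ?(ltW b0).
have mres D : measurable_fun D (fun s : R => (residual b eta (tau - s))%:E).
  by apply/measurable_EFinP; exact: measurable_residual_subl.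
apply: (@le_trans _ _ (\int[@lebesgue_measure R]_(s in `[0%R, tau])
   (eps%:E * (residual b eta (tau - s))%:E + K%:E))%E).
  apply: ge0_le_integral => //=.
  - by move=> s /wM/andP[w0 _]; rewrite lee_fin mulr_ge0 ?residual_ge0.
  - apply/measurable_EFinP; apply: measurable_funM => //; exact: measurable_residual_subl.
  - apply: emeasurable_funD => //.
    by apply: measurable_funeM; exact: mres.
  - move=> s sI; rewrite -EFinM -EFinD lee_fin.
    have /andP[w0 wM1] := wM s sI.
    have r0 : 0 <= residual b eta (tau - s) := residual_ge0 _ _ b0.
    have [/(weps s sI) we|rs] := ltP (tau - s) rho.
      by rewrite -[leLHS]addr0 lerD// ler_wpM2r.
    rewrite -[leLHS]add0r lerD ?mulr_ge0// /K ler_pM//.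
    rewrite ge_min; apply/orP; right; rewrite ler_wpM2l ?divr_ge0 ?powR_ge0 ?(ltW b0)//.
    have -> : b - 1 - 1 = - (2 - b) by ring.
    rewrite !powRN lef_pV2 ?posrE ?powR_gt0//; last exact: lt_le_trans rs.
    apply: ge0_ler_powR; rewrite ?nnegrE ?(ltW rho0)//; first by lra.
    exact: le_trans (ltW rho0) rs.
rewrite ge0_integralD//=; last 2 first.
- by move=> s _; rewrite -EFinM lee_fin mulr_ge0 ?residual_ge0.
- by apply: measurable_funeM; exact: mres.
rewrite ge0_integralZl_EFin//; last 2 first.
- by move=> s _; rewrite lee_fin residual_ge0.
- exact: mres.
rewrite integral_cst//= lebesgue_measure_itv/= lte_fin tau0 -EFinD subr0 -EFinM.
rewrite EFinD (mulrC tau) leeD2r// EFinM; apply: lee_wpmul2l; first by rewrite lee_fin.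
exact: integral_residual_le.
Qed.

(** * Convolution with the fractional kernel *)

(** Extended-real valued, so that convolutions of nonnegative functions can be
    compared and interchanged before they are known to be finite. *)
Definition frac_conv (R : realType) (b : R) (w : R -> R) (t : R) : \bar R :=
  (\int[@lebesgue_measure R]_(s in `[0%R, t]) ((t - s) `^ (b - 1) * w s)%:E)%E.

Lemma frac_conv_ge0 (R : realType) (b t : R) (w : R -> R) :
  (forall s, s \in `[0, t] -> 0 <= w s) -> (0 <= frac_conv b w t)%E.
Proof.
by move=> w0; apply: integral_ge0 => s /w0 ws; rewrite lee_fin mulr_ge0 ?powR_ge0.
Qed.

Lemma frac_conv_cut_powR (R : realType) (b tau h : R) (w : R -> R) : 0 <= h ->
  (frac_conv b w (tau - h) =
   \int[@lebesgue_measure R]_s ((w \_ `[0%R, tau]) s * cut_powR b (tau - h - s))%:E)%E.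
Proof.
move=> h0; rewrite /frac_conv integral_mkcond; apply: eq_integral => s _.
rewrite patchE; case: ifPn; rewrite ?notin_setE ?inE/= in_itv/=.
  move=> /andP[s0 sh]; rewrite cut_powRE ?subr_ge0// patchE mem_set 1?mulrC//=.
  by rewrite in_itv/= s0/= (le_trans sh)// gerBl.
move=> /negP; rewrite negb_and -!ltNge => /orP[s0|hs].
  rewrite patchE memNset ?mul0r//= in_itv/= => /andP[].
  by rewrite leNgt s0.
rewrite /cut_powR [X in _ * X]patchE memNset ?mulr0//= in_itv/= andbT.
by rewrite subr_ge0 leNgt hs.
Qed.

Lemma measurable_frac_conv_kernel (R : realType) (b tau : R) (W : R -> R) :
  measurable_fun [set: R] W ->
  measurable_fun [set: measurableTypeR R * measurableTypeR R]
    (fun x => W x.2 * cut_powR b (tau - x.1 - x.2)).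
Proof.
move=> mW; apply: measurable_funM; first exact: (measurableT_comp mW measurable_snd).
apply: (measurableT_comp (measurable_cut_powR b)).
by apply: measurable_funB => //; apply: measurable_funB.
Qed.

Lemma measurable_frac_conv_subl (R : realType) (b eta del tau : R) (w : R -> R) :
  0 <= eta -> measurable_fun `[0, tau] w ->
  (forall s, s \in `[0, tau] -> 0 <= w s) ->
  measurable_fun `[eta, del] (fun h => frac_conv b w (tau - h)).
Proof.
move=> eta0 mw w0.
pose W : R -> R := w \_ `[0, tau].
have W0 s : 0 <= W s by rewrite /W patchE; case: ifP => //; rewrite inE; exact: w0.
have mW : measurable_fun [set: R] W.
  exact: ((measurable_restrictT w (measurable_itv `[0, tau])).1 mw).
pose f (x : measurableTypeR R * measurableTypeR R) : R := W x.2 * cut_powR b (tau - x.1 - x.2).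
have f0 x : (0 <= (f x)%:E)%E by rewrite lee_fin mulr_ge0 ?cut_powR_ge0.
have mf : measurable_fun [set: measurableTypeR R * measurableTypeR R] (fun x => (f x)%:E).
  by apply/measurable_EFinP; exact: measurable_frac_conv_kernel.
have mF : measurable_fun [set: R] (fun h : R => \int[@lebesgue_measure R]_s (f (h, s))%:E)%E.
  exact: (@measurable_fun_fubini_tonelli_F _ _ (measurableTypeR R) (measurableTypeR R) R lebesgue_measure (fun x => (f x)%:E)).
apply: eq_measurable_fun (measurable_funTS mF) => h; rewrite inE/= in_itv/= => /andP[etah _].
by rewrite frac_conv_cut_powR// (le_trans eta0).
Qed.

(** The pointwise inequality [weighted_kernel_le] at z = tau - s, multiplied by
    w s and integrated in s; Tonelli's theorem turns the double integral into
    one over the translated convolutions. *)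
Lemma weighted_conv_le (R : realType) (b eta del tau : R) (w : R -> R) :
  0 < b -> b < 1 -> 0 < eta -> eta < del -> del <= tau ->
  measurable_fun `[0, tau] w ->
  (forall s, s \in `[0, tau] -> 0 <= w s) ->
  (((eta `^ (- b) - del `^ (- b)) / b)%:E * frac_conv b w tau <=
   \int[@lebesgue_measure R]_(h in `[eta, del])
     ((h `^ (- b - 1))%:E * frac_conv b w (tau - h)) +
   \int[@lebesgue_measure R]_(s in `[0%R, tau]) (w s * residual b eta (tau - s))%:E)%E.
Proof.
move=> b0 b1 eta0 etadel deltau mw w0.
have del0 : 0 < del := lt_trans eta0 etadel.
have tau0 : 0 < tau := lt_le_trans del0 deltau.
pose A : R -> R := (fun h : R => h `^ (- b - 1)) \_ `[eta, del].
pose W : R -> R := w \_ `[0, tau].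
have A0 h : 0 <= A h by rewrite /A patchE; case: ifP => // _; exact: powR_ge0.
have W0 s : 0 <= W s by rewrite /W patchE; case: ifP => //; rewrite inE; exact: w0.
have mA : measurable_fun [set: R] A.
  apply: ((measurable_restrictT (fun x : R => x `^ (- b - 1)) (measurable_itv `[eta, del])).1 _).
  by apply: measurable_funTS; exact: measurable_powR.
have mW : measurable_fun [set: R] W.
  exact: ((measurable_restrictT w (measurable_itv `[0, tau])).1 mw).
pose f (x : measurableTypeR R * measurableTypeR R) : R := A x.1 * (W x.2 * cut_powR b (tau - x.1 - x.2)).
have f0 x : 0 <= f x by rewrite !mulr_ge0 ?cut_powR_ge0.
have mf : measurable_fun [set: measurableTypeR R * measurableTypeR R] f.
  apply: measurable_funM; first exact: (measurableT_comp mA measurable_fst).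
  exact: measurable_frac_conv_kernel.
have Ef0 x : (0 <= (f x)%:E)%E by rewrite lee_fin.
have mEf : measurable_fun [set: measurableTypeR R * measurableTypeR R] (fun x => (f x)%:E) by exact/measurable_EFinP.
have mWk h : measurable_fun [set: R] (fun s : R => W s * cut_powR b (tau - h - s)).
  apply: measurable_funM => //; apply: (measurableT_comp (measurable_cut_powR b)).
  exact: measurable_funB.
have Fh : (\int[@lebesgue_measure R]_(h in `[eta, del]) ((h `^ (- b - 1))%:E * frac_conv b w (tau - h)) =
    \int[@lebesgue_measure R]_h \int[@lebesgue_measure R]_s (f (h, s))%:E)%E.
  rewrite integral_mkcond. apply: eq_integral => h _.
  under eq_integral do rewrite /f/= EFinM.
  rewrite ge0_integralZl_EFin//; last 2 first.
  - by move=> s _; rewrite lee_fin mulr_ge0 ?cut_powR_ge0.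
  - by apply/measurable_EFinP; exact: mWk.
  rewrite /A !patchE; case: ifPn => hI; last by rewrite mul0e.
  congr (_ * _)%E; apply: frac_conv_cut_powR; move: hI; rewrite inE/= in_itv/= => /andP[etah _].
  exact: le_trans (ltW eta0) etah.
pose I (s : R) := (\int[@lebesgue_measure R]_(h in `[eta, del])
      (h `^ (- b - 1) * cut_powR b (tau - s - h))%:E)%E.
have I0 s : (0 <= I s)%E.
  by apply: integral_ge0 => h _; rewrite lee_fin mulr_ge0 ?powR_ge0 ?cut_powR_ge0.
have Gs s : (\int[@lebesgue_measure R]_h (f (h, s))%:E = (W s)%:E * I s)%E.
  have fE h : (f (h, s))%:E = ((W s)%:E * (A h * cut_powR b (tau - s - h))%:E)%E.
    by rewrite -EFinM /f/=; congr (_%:E); rewrite [tau - h - s]addrAC; ring.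
  under eq_integral do rewrite fE.
  rewrite ge0_integralZl_EFin//; last 2 first.
  - by move=> h _; rewrite lee_fin mulr_ge0 ?cut_powR_ge0.
  - apply/measurable_EFinP; apply: measurable_funM => //.
    apply: (measurableT_comp (measurable_cut_powR b)); exact: measurable_funB.
  congr (_ * _)%E; rewrite [RHS]integral_mkcond; apply: eq_integral => h _.
  by rewrite /A !patchE; case: ifPn => // _; rewrite mul0r.
have Ws s : s \in `[0, tau] -> W s = w s.
  by move=> sI; rewrite /W patchE mem_set.
have Fs : (\int[@lebesgue_measure R]_s \int[@lebesgue_measure R]_h (f (h, s))%:E =
    \int[@lebesgue_measure R]_(s in `[0%R, tau]) ((w s)%:E * I s))%E.
  rewrite [RHS]integral_mkcond; apply: eq_integral => s _.
  by rewrite Gs /W !patchE; case: ifPn => // _; rewrite mul0e.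
have mI : measurable_fun `[0, tau] (fun s : R => ((w s)%:E * I s)%E).
  have mG : measurable_fun [set: R] (fun s : R => \int[@lebesgue_measure R]_h (f (h, s))%:E)%E.
    exact: (@measurable_fun_fubini_tonelli_G _ _ (measurableTypeR R) (measurableTypeR R) R lebesgue_measure (fun x => (f x)%:E)).
  apply: eq_measurable_fun (measurable_funTS mG) => s; rewrite inE/= => sI.
  by rewrite Gs Ws.
have tonelli : (\int[@lebesgue_measure R]_h \int[@lebesgue_measure R]_s (f (h, s))%:E = \int[@lebesgue_measure R]_s \int[@lebesgue_measure R]_h (f (h, s))%:E)%E.
  apply: (@fubini_tonelli _ _ (measurableTypeR R) (measurableTypeR R) R lebesgue_measure lebesgue_measure (fun x => (f x)%:E)); [exact: mEf|exact: Ef0].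
move: Fh; rewrite tonelli Fs => Fh.
rewrite Fh; move: mI Gs => {Fh Fs tonelli mEf Ef0 mWk mf f0 f mW mA W0 A0 Ws} mI _ {W A}.
have mWr : measurable_fun `[0, tau] (fun s => (w s * residual b eta (tau - s))%:E).
  by apply/measurable_EFinP; apply: measurable_funM => //; exact: measurable_residual_subl.
have mKw : measurable_fun `[0, tau] (fun s => ((tau - s) `^ (b - 1) * w s)%:E).
  by apply/measurable_EFinP; apply: measurable_funM => //; exact: measurable_subl_powR.
have K0 : 0 <= (eta `^ (- b) - del `^ (- b)) / b.
  rewrite divr_ge0 ?(ltW b0)// subr_ge0 !powRN lef_pV2 ?posrE ?powR_gt0//.
  by apply: ge0_ler_powR; rewrite ?nnegrE ?(ltW b0) ?(ltW eta0) ?(ltW del0) ?(ltW etadel).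
rewrite -ge0_integralD//; last 2 first.
- by move=> s sI; rewrite mule_ge0// lee_fin w0.
- by move=> s sI; rewrite lee_fin mulr_ge0 ?residual_ge0 ?w0.
rewrite /frac_conv -ge0_integralZl_EFin//; last first.
- by move=> s sI; rewrite lee_fin mulr_ge0 ?powR_ge0 ?w0.
apply: ge0_le_integral => //.
- by move=> s sI; rewrite mule_ge0// lee_fin// mulr_ge0 ?powR_ge0 ?w0.
- by apply: measurable_funeM.
- by apply: emeasurable_funD.
move=> s sI; have ws := w0 s sI.
have zs : 0 <= tau - s by move: sI; rewrite /= in_itv/= subr_ge0 => /andP[].
have := weighted_kernel_le b0 b1 eta0 etadel zs; rewrite -/(I s) => ker.
have := lee_wpmul2l _ ker; rewrite -EFinM => /(_ (w s)%:E); rewrite lee_fin => /(_ ws).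
rewrite ge0_muleDr//; last by rewrite lee_fin residual_ge0.
rewrite -!EFinM; apply: le_trans; rewrite lee_fin.
by rewrite le_eqVlt; apply/orP; left; apply/eqP; ring.
Qed.

Lemma frac_conv_fin_num (R : realType) (b t M : R) (w : R -> R) :
  0 < b -> 0 < t -> measurable_fun `[0, t] w ->
  (forall s, s \in `[0, t] -> 0 <= w s <= M) -> frac_conv b w t \is a fin_num.
Proof.
move=> b0 t0 mw wM.
have cv0 : (0 <= frac_conv b w t)%E by apply: frac_conv_ge0 => s /wM/andP[].
rewrite ge0_fin_numE//.
apply: (@le_lt_trans _ _ (\int[@lebesgue_measure R]_(s in `[0%R, t]) (M * (t - s) `^ (b - 1))%:E)%E).
  apply: ge0_le_integral => //.
  - by move=> s /wM/andP[ws _]; rewrite lee_fin mulr_ge0 ?powR_ge0.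
  - by apply/measurable_EFinP; apply: measurable_funM => //; exact: measurable_subl_powR.
  - by apply/measurable_EFinP; apply: measurable_funM => //; exact: measurable_subl_powR.
  - by move=> s /wM/andP[_ ws]; rewrite lee_fin mulrC ler_wpM2r ?powR_ge0.
have M0 : 0 <= M.
  have /wM/andP[] : (0 : R) \in `[0, t] by rewrite in_itv/= lexx ltW.
  exact: le_trans.
by rewrite integralZ_subl_powR ?gt_eqF ?b0// ltry.
Qed.

(** * Nonnegative convolutions do not increase linearly into a zero *)

(** Integrating the assumed increase c h against h^(- b - 1) over [eta, del] gives
    the left-hand side; [weighted_conv_le] shows that the convolutions cancel up
    to the integral of w against the residual. *)
Lemma frac_conv_drop_bound (R : realType) (b eta del tau c M eps rho : R) (w : R -> R) :
  0 < b -> b < 1 -> 0 < eta -> eta < del -> del <= tau -> 0 <= c ->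
  measurable_fun `[0, tau] w ->
  (forall s, s \in `[0, tau] -> 0 <= w s <= M) ->
  0 <= eps -> 0 < rho ->
  (forall s, s \in `[0, tau] -> tau - s < rho -> w s <= eps) ->
  (forall h, 0 < h -> h <= del ->
    (frac_conv b w (tau - h) + (c * h)%:E <= frac_conv b w tau)%E) ->
  c * ((del `^ (1 - b) - eta `^ (1 - b)) / (1 - b)) <=
  eps * (b^-1 ^+ 2 + (b * (1 - b))^-1) +
    tau * (M * (eta `^ (1 - b) / b * rho `^ (b - 1 - 1))).
Proof.
move=> b0 b1 eta0 etadel deltau c0 mw wM eps0 rho0 weps drop.
have del0 : 0 < del := lt_trans eta0 etadel.
have tau0 : 0 < tau := lt_le_trans del0 deltau.
have etatau : eta < tau := lt_le_trans etadel deltau.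
have w0 s : s \in `[0, tau] -> 0 <= w s by move=> /wM/andP[].
have cfin := frac_conv_fin_num b0 tau0 mw wM.
pose X := (\int[@lebesgue_measure R]_(h in `[eta, del])
     ((h `^ (- b - 1))%:E * frac_conv b w (tau - h)))%E.
pose K := (eta `^ (- b) - del `^ (- b)) / b.
set D := c * _.
have D0 : 0 <= D.
  rewrite mulr_ge0// divr_ge0 ?subr_ge0 ?(ltW b1)//.
  by apply: ge0_ler_powR; rewrite ?nnegrE ?subr_ge0 ?(ltW b1) ?(ltW eta0) ?(ltW del0) ?(ltW etadel).
have X0 : (0 <= X)%E.
  apply: integral_ge0 => h; rewrite /= in_itv/= => /andP[etah _].
  rewrite mule_ge0 ?lee_fin ?powR_ge0//; apply: frac_conv_ge0 => s.
  rewrite in_itv/= => /andP[s0 sh]; apply: w0; rewrite in_itv/= s0/=.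
  by rewrite (le_trans sh)// gerBl (le_trans (ltW eta0)).
have mpow p : measurable_fun `[eta, del] (fun h : R => (h `^ p)%:E).
  by apply/measurable_EFinP/measurable_funTS; exact: measurable_powR.
have XD : (X + D%:E <= K%:E * frac_conv b w tau)%E.
  have EK : K%:E = (\int[@lebesgue_measure R]_(h in `[eta, del]) (h `^ (- b - 1))%:E)%E.
    rewrite integral_powR ?eta0 ?orbT ?(ltW eta0) ?oppr_eq0 ?gt_eqF//.
    by congr (_%:E); rewrite /K; field; rewrite gt_eqF.
  have ED : D%:E = (\int[@lebesgue_measure R]_(h in `[eta, del]) (c * h `^ (1 - b - 1))%:E)%E.
    under eq_integral do rewrite EFinM.
    rewrite ge0_integralZl_EFin//; last 2 first.
    - by move=> h _; rewrite lee_fin powR_ge0.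
    - exact: mpow.
    by rewrite integral_powR ?eta0 ?orbT ?(ltW eta0) ?subr_eq0 ?gt_eqF.
  have mc : measurable_fun `[eta, del] (fun h => (h `^ (- b - 1))%:E * frac_conv b w (tau - h))%E.
    by apply: emeasurable_funM => //; apply: measurable_frac_conv_subl => //; exact: ltW.
  have mp : measurable_fun `[eta, del] (fun h : R => (c * h `^ (1 - b - 1))%:E).
    apply/measurable_EFinP; apply: measurable_funM => //.
    by apply: measurable_funTS; exact: measurable_powR.
  have nn h : h \in `[eta, del] -> (0 <= (h `^ (- b - 1))%:E * frac_conv b w (tau - h))%E.
    rewrite in_itv/= => /andP[etah _].
    rewrite mule_ge0 ?lee_fin ?powR_ge0//; apply: frac_conv_ge0 => s.
    rewrite in_itv/= => /andP[s0 sh]; apply: w0; rewrite in_itv/= s0/=.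
    by rewrite (le_trans sh)// gerBl (le_trans (ltW eta0)).
  have EKc : (\int[@lebesgue_measure R]_(h in `[eta, del])
      ((h `^ (- b - 1))%:E * frac_conv b w tau) = K%:E * frac_conv b w tau)%E.
    rewrite EK ge0_integralZr//; first exact: mpow.
    - by move=> h _; rewrite lee_fin powR_ge0.
    - exact: frac_conv_ge0.
  have EXD : (\int[@lebesgue_measure R]_(h in `[eta, del])
      ((h `^ (- b - 1))%:E * frac_conv b w (tau - h) + (c * h `^ (1 - b - 1))%:E) = X + D%:E)%E.
    rewrite ge0_integralD//; first by rewrite ED.
    by move=> h _; rewrite lee_fin mulr_ge0 ?powR_ge0.
  rewrite -EKc -EXD {EKc EXD EK ED}.
  apply: ge0_le_integral.
  - exact: measurable_itv.
  - by move=> h hI; rewrite adde_ge0 ?nn// lee_fin mulr_ge0 ?powR_ge0.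
  - by apply: emeasurable_funD.
  - by apply: emeasurable_funM => //; exact: mpow.
  move=> h; rewrite /= in_itv/= => /andP[etah hdel].
  have h0 : 0 < h := lt_le_trans eta0 etah.
  have distr (u : \bar R) : ((h `^ (- b - 1))%:E * u + (c * h `^ (1 - b - 1))%:E =
      (h `^ (- b - 1))%:E * (u + (c * h)%:E))%E.
    rewrite muleDr ?fin_num_adde_defl// -EFinM mulrCA; congr (_ + (c * _)%:E)%E.
    rewrite mulrC -{2}(powRr1 (ltW h0)) -powRD ?(gt_eqF h0) ?implybT//.
    by congr (_ `^ _); ring.
  rewrite distr; apply: lee_wpmul2l; first by rewrite lee_fin powR_ge0.
  exact: drop.
have := integral_mul_residual_le b0 b1 eta0 etatau rho0 eps0 mw wM weps.
set y := (X in (_ <= X%:E)%E) => Yy.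
have := le_trans (weighted_conv_le b0 b1 eta0 etadel deltau mw w0) (leeD2l _ Yy).
rewrite -/X -/K => KX.
move: KX XD {Yy}; rewrite -(fineK cfin) -EFinM => KX XD.
have Xfin : X \is a fin_num.
  rewrite ge0_fin_numE//; apply: le_lt_trans (leeDl _ _) (le_lt_trans XD (ltry _)).
  by rewrite lee_fin.
move: KX XD; rewrite -(fineK Xfin) -!EFinD !lee_fin.
move=> h1 h2; rewrite -(lerD2l (fine X)); exact: le_trans h2 h1.
Qed.

(** In [frac_conv_drop_bound] let first eps and then eta tend to 0: the right-hand
    side vanishes in the limit while the left-hand side stays positive. *)
Lemma frac_conv_no_linear_drop (R : realType) (b del tau c M : R) (w : R -> R) :
  0 < b -> b < 1 -> 0 < del -> del <= tau -> 0 < c ->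
  measurable_fun `[0, tau] w ->
  (forall s, s \in `[0, tau] -> 0 <= w s <= M) ->
  (forall eps, 0 < eps -> exists2 rho, 0 < rho &
     forall s, s \in `[0, tau] -> tau - s < rho -> w s <= eps) ->
  (forall h, 0 < h -> h <= del ->
    (frac_conv b w (tau - h) + (c * h)%:E <= frac_conv b w tau)%E) -> False.
Proof.
move=> b0 b1 del0 deltau c0 mw wM wtau drop.
have b1' : 0 < 1 - b by rewrite subr_gt0.
have tau0 : 0 < tau := lt_le_trans del0 deltau.
have M0 : 0 <= M.
  have /wM/andP[] : (0 : R) \in `[0, tau] by rewrite in_itv/= lexx ltW.
  exact: le_trans.
pose C := b^-1 ^+ 2 + (b * (1 - b))^-1.
have C0 : 0 < C by rewrite addr_gt0 ?exprn_gt0 ?invr_gt0 ?mulr_gt0.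
pose S := c * (del `^ (1 - b) / (1 - b)).
have S0 : 0 < S by rewrite mulr_gt0 ?divr_gt0 ?powR_gt0.
(* S is the limit of the left-hand side of the bound as eta tends to 0; eps makes
   the first term on the right S / 4, and eta <= q^(1/(1-b)) makes the terms in
   eta^(1 - b) at most S / 2. *)
pose eps := S / (4 * C).
have eps0 : 0 < eps by rewrite divr_gt0// mulr_gt0// ltr0n.
have [rho rho0 wrho] := wtau _ eps0.
pose Z := tau * (M * (b^-1 * rho `^ (b - 1 - 1))) + c / (1 - b).
have Z0 : 0 < Z.
  rewrite ltr_wpDl ?divr_gt0// !mulr_ge0 ?powR_ge0 ?invr_ge0 ?(ltW tau0) ?(ltW b0)//.
pose q := S / (2 * Z).
have q0 : 0 < q by rewrite divr_gt0// mulr_gt0// ltr0n.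
pose eta := Num.min (del / 2) (q `^ (1 - b)^-1).
have eta0 : 0 < eta by rewrite lt_min divr_gt0 ?powR_gt0.
have etadel : eta < del.
  by rewrite gt_min ltr_pdivrMr// ltr_pMr// ltr1n.
have etaq : eta `^ (1 - b) <= q.
  have -> : q = (q `^ (1 - b)^-1) `^ (1 - b).
    by rewrite -powRrM mulVf ?gt_eqF// powRr1 ?(ltW q0).
  apply: ge0_ler_powR; rewrite ?nnegrE ?powR_ge0 ?(ltW b1') ?(ltW eta0)//.
  by rewrite ge_min lexx orbT.
have := frac_conv_drop_bound b0 b1 eta0 etadel deltau (ltW c0) mw wM (ltW eps0) rho0 wrho drop.
have -> : eps * (b^-1 ^+ 2 + (b * (1 - b))^-1) = S / 4.
  by rewrite -/C /eps; field; rewrite gt_eqF.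
have bn : b != 0 by rewrite gt_eqF.
have b1n : 1 - b != 0 by rewrite gt_eqF.
have -> : c * ((del `^ (1 - b) - eta `^ (1 - b)) / (1 - b)) =
    S - c / (1 - b) * eta `^ (1 - b) by rewrite /S; field.
have -> : tau * (M * (eta `^ (1 - b) / b * rho `^ (b - 1 - 1))) =
   Z * eta `^ (1 - b) - c / (1 - b) * eta `^ (1 - b).
  by rewrite /Z; field; rewrite b1n bn.
have : Z * eta `^ (1 - b) <= Z * q by rewrite ler_pM2l.
have -> : Z * q = S / 2 by rewrite /q; field; rewrite gt_eqF.
by move: S0; lra.
Qed.

(** * The fractional derivative at a minimum *)

Lemma powR_concave_drop (R : realType) (b x h : R) : 0 < b -> b < 1 -> 0 < h -> h < x ->
  h * x `^ (b - 1) <= (x `^ b - (x - h) `^ b) / b.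
Proof.
move=> b0 b1 h0 hx.
have x0 : 0 < x := lt_trans h0 hx.
have xh : x - h < x by rewrite ltrBlDr ltrDl.
have pos y : y \in `[x - h, x] -> 0 < y.
  by rewrite in_itv/= => /andP[+ _]; apply: lt_le_trans; rewrite subr_gt0.
have [||xi xiI ->] := @MVT R (fun y => y `^ b) (fun y => b * y `^ (b - 1)) _ _ xh.
- by move=> y /subset_itv_oo_cc/pos; exact: is_derive1_powR.
- by apply/continuous_in_subspaceT => y; rewrite inE => /pos; exact: powR_continuous.
have xi0 : 0 < xi by apply: pos; exact: subset_itv_oo_cc.
rewrite subKr mulrAC [b * _]mulrC mulfK ?gt_eqF// mulrC ler_pM2r//.
have -> : b - 1 = - (1 - b) by ring.
rewrite !powRN lef_pV2 ?posrE ?powR_gt0//.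
move: xiI; rewrite in_itv/= => /andP[_ xix].
by apply: ge0_ler_powR; rewrite ?nnegrE ?subr_ge0 ?(ltW b1) ?(ltW xi0) ?(ltW x0) ?(ltW xix).
Qed.

Lemma integrable_subl_powR_mul (R : realType) (b t M : R) (phi : R -> R) :
  0 < b -> 0 < t -> measurable_fun `[0, t] phi ->
  (forall s, s \in `[0, t] -> `|phi s| <= M) ->
  (@lebesgue_measure R).-integrable `[0, t] (fun s => ((t - s) `^ (b - 1) * phi s)%:E).
Proof.
move=> b0 t0 mphi bphi.
have M0 : 0 <= M.
  have /bphi : (0 : R) \in `[0, t] by rewrite in_itv/= lexx ltW.
  exact: le_trans.
apply: (@le_integrable _ (measurableTypeR R) _ _ _ _ _ (fun s => (M * (t - s) `^ (b - 1))%:E)).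
- exact: measurable_itv.
- by apply/measurable_EFinP; apply: measurable_funM => //; exact: measurable_subl_powR.
- move=> s sI /=; rewrite lee_fin !normrM mulrC (ger0_norm M0).
  by rewrite ler_wpM2r// bphi.
apply/integrableP; split.
  by apply/measurable_EFinP; apply: measurable_funM => //; exact: measurable_subl_powR.
under eq_integral => s _ do rewrite gee0_abs ?lee_fin ?mulr_ge0 ?powR_ge0//.
by rewrite integralZ_subl_powR ?gt_eqF ?b0// ltry.
Qed.

(** The two explicit terms are the convolutions of the step m 1_{s > a} and of the
    constant u 0, which separate u s - u 0 from the nonnegative part w. *)
Lemma Rintegral_caputo_split (R : realType) (b a t m M : R) (u w : R -> R) :
  0 < b -> 0 <= a -> a < t ->
  measurable_fun `[0, t] w ->
  (forall s, s \in `[0, t] -> `|w s| <= M) ->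
  (forall s, s \in `[0, t] -> w s = u s + m * \1_(`]a, t]) s) ->
  \int[@lebesgue_measure R]_(s in `[0, t]) ((t - s) `^ (b - 1) * (u s - u 0)) =
  \int[@lebesgue_measure R]_(s in `[0, t]) ((t - s) `^ (b - 1) * w s)
  - m * ((t - a) `^ b / b) - u 0 * (t `^ b / b).
Proof.
move=> b0 a0 at_ mw bw wE.
have t0 : 0 < t := le_lt_trans a0 at_.
have mI : measurable_fun `[0, t] (fun s : R => \1_(`]a, t]) s : R).
  by apply: measurable_funTS; apply: measurable_indic; exact: measurable_itv.
have iw := integrable_subl_powR_mul b0 t0 mw bw.
have i1 : (@lebesgue_measure R).-integrable `[0, t] (fun s : R => ((t - s) `^ (b - 1) * \1_(`]a, t]) s)%:E).
  apply: (@integrable_subl_powR_mul _ _ _ 1) => // s _.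
  by rewrite indicE; case: (_ \in _); rewrite ?normr0 ?normr1.
have i2 : (@lebesgue_measure R).-integrable `[0, t] (fun s : R => ((t - s) `^ (b - 1))%:E).
  have i3 : (@lebesgue_measure R).-integrable `[0, t] (fun s : R => ((t - s) `^ (b - 1) * cst 1 s)%:E).
    apply: (@integrable_subl_powR_mul _ _ _ 1) => // s _.
    by rewrite /cst normr1.
  by apply: eq_integrable i3 => // s _; rewrite /cst mulr1.
have -> : \int[@lebesgue_measure R]_(s in `[0, t]) ((t - s) `^ (b - 1) * (u s - u 0)) =
  \int[@lebesgue_measure R]_(s in `[0, t]) ((t - s) `^ (b - 1) * w s -
    m * ((t - s) `^ (b - 1) * \1_(`]a, t]) s) - u 0 * (t - s) `^ (b - 1)).
  by apply: eq_Rintegral => s; rewrite inE/= => sI; rewrite wE//; ring.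
have im : (@lebesgue_measure R).-integrable `[0, t] (fun s : R => (m * ((t - s) `^ (b - 1) * \1_(`]a, t]) s))%:E).
  by apply: integrableZl i1; exact: measurable_itv.
have iu : (@lebesgue_measure R).-integrable `[0, t] (fun s : R => (u 0 * (t - s) `^ (b - 1))%:E).
  by apply: integrableZl i2; exact: measurable_itv.
rewrite RintegralB//; last first.
  by apply: integrableB iw im; exact: measurable_itv.
rewrite RintegralB// !RintegralZl//; congr (_ - _ * _ - _ * _).
- rewrite /Rintegral.
  have -> : (\int[@lebesgue_measure R]_(s in `[0%R, t]) ((t - s) `^ (b - 1) * \1_(`]a, t]) s)%:E =
     \int[@lebesgue_measure R]_(s in `[a, t]) ((t - s) `^ (b - 1))%:E)%E.
    rewrite -[RHS]integral_itv_obnd_cbnd; last first.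
      by apply/measurable_EFinP; exact: measurable_subl_powR.
    rewrite [LHS]integral_mkcond [RHS]integral_mkcond; apply: eq_integral => s _.
    rewrite !patchE indicE; case: (boolP (s \in `]a, t]%classic)) => [sa|_]; last by rewrite mulr0 if_same.
    rewrite mem_set ?mulr1//=; move: sa; rewrite inE/= !in_itv/= => /andP[sa ->].
    by rewrite (le_trans a0 (ltW sa)).
  by rewrite integral_subl_powR ?gt_eqF ?b0//= subrr powR0 ?gt_eqF// subr0.
- rewrite /Rintegral integral_subl_powR ?gt_eqF ?b0//=.
  by rewrite subrr powR0 ?gt_eqF// !subr0.
Qed.

Lemma within_continuous_measurable (R : realType) (a b : R) (u : R -> R) :
  {within `[a, b], continuous u} -> measurable_fun `[a, b] u.
Proof.
move=> cu; apply/measurable_EFinP.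
have := continuous_compact_integrable (@segment_compact R a b) cu.
exact: measurable_int.
Qed.

(** Raising u by m after time a makes it nonnegative with a zero at tau, and a
    nonnegative function contributes no positive slope there
    ([frac_conv_no_linear_drop]).  The step of height m at a then accounts for the
    bound, and the constant u 0 >= 0 only lowers the slope further. *)
Lemma frac_conv_left_slope_at_minimum (R : realType) (b a tau m c del : R) (u : R -> R) :
  let F t := \int[@lebesgue_measure R]_(s in `[0, t]) ((t - s) `^ (b - 1) * (u s - u 0)) in
  0 < b -> b < 1 -> 0 <= a -> 0 <= m -> 0 < del -> del < tau - a ->
  {within `[0, tau], continuous u} ->
  (forall s, s \in `[0, a] -> 0 <= u s) ->
  (forall s, s \in `[a, tau] -> - m <= u s) -> u tau = - m ->
  (forall h, 0 < h -> h <= del -> c * h <= F tau - F (tau - h)) ->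
  c <= - (m * (tau - a) `^ (b - 1)).
Proof.
move=> F b0 b1 a0 m0 del0 deltau cu u0 um utau drop.
rewrite leNgt; apply/negP => cm.
have atau : a < tau by rewrite -subr_gt0 (lt_trans del0).
have tau0 : 0 < tau := le_lt_trans a0 atau.
(* u raised by m after time a. *)
pose w s := u s + m * \1_(`]a, tau]) s.
have mu_ : measurable_fun `[0, tau] u by exact: within_continuous_measurable.
have mw : measurable_fun `[0, tau] w.
  have mI : measurable_fun `[0, tau] (fun s : R => \1_(`]a, tau]) s : R).
    by apply: measurable_funTS; apply: measurable_indic; exact: measurable_itv.
  by apply: measurable_funD => //; apply: measurable_funM.
have w0 s : s \in `[0, tau] -> 0 <= w s.
  rewrite in_itv/= => /andP[s0 st]; rewrite /w indicE.
  have [sa|as_] := leP s a.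
    by rewrite addr_ge0 ?mulr_ge0// u0// in_itv/= s0.
  rewrite mem_set/= ?in_itv/= ?as_// mulr1 -lerBlDr sub0r um// in_itv/= st.
  by rewrite (ltW as_).
have [x0 _ umax] := EVT_max (ltW tau0) cu.
pose M := u x0 + m.
have wM s : s \in `[0, tau] -> 0 <= w s <= M.
  move=> sI; rewrite w0//=; apply: lerD; first exact: umax.
  by rewrite indicE; case: (_ \in _); rewrite ?mulr1 ?mulr0.
have wtau eps : 0 < eps -> exists2 rho, 0 < rho &
     forall s, s \in `[0, tau] -> tau - s < rho -> w s <= eps.
  move=> eps0.
  have [_ _ ul] := (continuous_within_itvP u tau0).1 cu.
  move/cvgrPdist_lt : ul => /(_ _ eps0)[/= r r0 ur].
  exists (Num.min r (tau - a)); first by rewrite lt_min r0 subr_gt0.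
  move=> s; rewrite in_itv/= => /andP[s0 st]; rewrite lt_min => /andP[sr sa].
  have as_ : a < s by move: sa; rewrite ltrD2l ltrN2.
  rewrite /w indicE mem_set/= ?in_itv/= ?as_// mulr1.
  move: st; rewrite le_eqVlt => /predU1P[->|st].
    by rewrite utau addNr ltW.
  have := ur s; rewrite /= ger0_norm ?subr_ge0 ?(ltW st)// => /(_ sr st).
  rewrite utau distrC opprK => h.
  exact: ltW (le_lt_trans (ler_norm _) h).
have FE t : a < t -> t <= tau -> F t = fine (frac_conv b w t) - m * ((t - a) `^ b / b) - u 0 * (t `^ b / b).
  move=> at_ ttau; rewrite /F (@Rintegral_caputo_split _ _ a _ m M _ w)//.
  - by apply: measurable_funS mw => //; apply: subset_itvl.
  - move=> s /(subset_itvl (_ : (BRight t <= BRight tau)%O)) sI.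
    have /wM/andP[ws wsM] : s \in `[0, tau] by apply: sI.
    by rewrite ger0_norm.
  - move=> s; rewrite in_itv/= => /andP[s0 st]; rewrite /w; congr (_ + m * _).
    rewrite !indicE; congr (_%:R); rewrite !mem_setE/= !in_itv/= st (le_trans st)//.
apply: (@frac_conv_no_linear_drop _ b del tau (c + m * (tau - a) `^ (b - 1)) M w) => //.
- by rewrite (le_trans (ltW deltau))// gerBl.
- by move: cm; lra.
move=> h h0 hdel.
have hta : h < tau - a := le_lt_trans hdel deltau.
have at_ : a < tau - h by move: hta; lra.
have tauh : tau - h < tau by rewrite ltrBlDr ltrDl.
have th0 : 0 < tau - h := le_lt_trans a0 at_.
have := drop h h0 hdel; rewrite !FE ?(ltW tauh)//.
have f1 : frac_conv b w tau \is a fin_num by exact: frac_conv_fin_num wM.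
have f2 : frac_conv b w (tau - h) \is a fin_num.
  apply: (@frac_conv_fin_num _ _ _ M) => //.
  - by apply: measurable_funS mw => //; apply: subset_itvl; rewrite bnd_simp ltW.
  - move=> s; rewrite in_itv/= => /andP[s0 st]; apply: wM.
    by rewrite in_itv/= s0 (le_trans st (ltW tauh)).
rewrite -{2}(fineK f1) -{2}(fineK f2) -EFinD lee_fin.
have d1 := powR_concave_drop b0 b1 h0 hta.
have htau : h < tau by rewrite (lt_le_trans hta)// gerBl.
have d2 := powR_concave_drop b0 b1 h0 htau.
have -> : tau - h - a = tau - a - h by ring.
have u00 : 0 <= u 0 by apply: u0; rewrite in_itv/= lexx.
have e1 := ler_wpM2l m0 d1.
have e2 : 0 <= u 0 * ((tau `^ b - (tau - h) `^ b) / b).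
  by rewrite mulr_ge0// (le_trans _ d2)// mulr_ge0 ?powR_ge0 ?(ltW h0).
have arith (p q A1 A2 B1 B2 X Y : R) : Y <= p - A1 - B1 - (q - A2 - B2) ->
    X <= A1 - A2 -> 0 <= B1 - B2 -> q + (Y + X) <= p by lra.
rewrite (mulrDl c) => dropE; apply: (arith _ _ _ _ _ _ _ _ dropE).
- by rewrite -mulrBr -mulrBl -mulrA [_ * h]mulrC.
- by rewrite -mulrBr -mulrBl.
Qed.

(** * The Gamma function on (0, 1) *)

(** The integral that defines [Gamma] is real valued, hence 0 if it diverges; the
    point is thus its convergence, by comparison with s^(b - 1) on [0, 1] and
    with exp (- s) beyond. *)
Lemma Gamma_gt0 (R : realType) (b : R) : 0 < b -> b < 1 -> 0 < Gamma b.
Proof.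
move=> b0 b1; rewrite /Gamma /Rintegral.
pose g (s : R) := s `^ (b - 1) * expR (- s).
have g0 s : 0 <= g s by rewrite mulr_ge0 ?powR_ge0 ?expR_ge0.
have mg (D : set R) : measurable_fun D (fun s => (g s)%:E).
  apply/measurable_EFinP; apply: measurable_funTS; apply: measurable_funM.
    exact: measurable_powR.
  by apply: (measurableT_comp (@measurable_expR R)).
(* The integrand is at most q plus the density of the exponential law. *)
pose q (s : R) := ((fun s : R => s `^ (b - 1)) \_ `[0, 1]) s.
have q0 s : 0 <= q s by rewrite /q patchE; case: ifP => // _; exact: powR_ge0.
have mq : measurable_fun [set: R] q.
  apply: ((measurable_restrictT (fun x : R => x `^ (b - 1)) (measurable_itv `[0, 1])).1 _).
  by apply: measurable_funTS; exact: measurable_powR.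
have me := @measurable_exponential_pdf R 1.
have e0 (s : R) : 0 <= exponential_pdf 1 s := exponential_pdf_ge0 ler01 s.
have gle s : s \in `[0, +oo[ -> g s <= q s + exponential_pdf 1 s.
  rewrite in_itv/= andbT => s0.
  have [s1|s1] := leP s 1.
    rewrite -[leLHS]addr0 lerD ?e0//.
    rewrite /q patchE mem_set/= ?in_itv/= ?s0//.
    by rewrite /g ler_piMr ?powR_ge0// -expR0 ler_expR oppr_le0.
  rewrite -[leLHS]add0r lerD ?q0//.
  rewrite exponential_pdfE// mul1r mulN1r /g.
  rewrite ler_piMl ?expR_ge0//.
  have -> : b - 1 = - (1 - b) by ring.
  rewrite powRN invf_le1 ?powR_gt0 ?(lt_trans ltr01)//.
  rewrite -[leLHS](powRr0 s) ler_powR ?(ltW s1)// subr_ge0 ltW//.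
have lty : (\int[@lebesgue_measure R]_(s in `[0%R, +oo[) (g s)%:E < +oo)%E.
  apply: (@le_lt_trans _ _ (\int[@lebesgue_measure R]_s ((q s)%:E + (exponential_pdf 1 s)%:E))%E).
    apply: (@le_trans _ _ (\int[@lebesgue_measure R]_(s in `[0%R, +oo[) ((q s)%:E + (exponential_pdf 1 s)%:E))%E).
      apply: ge0_le_integral => //.
      - by move=> s _; rewrite lee_fin.
      - exact: mg.
      - by apply: measurable_funTS; apply: emeasurable_funD; exact/measurable_EFinP.
    apply: ge0_subset_integral => //.
    - by apply: emeasurable_funD; exact/measurable_EFinP.
    - by move=> s _; rewrite -EFinD lee_fin addr_ge0 ?q0 ?e0.
  rewrite ge0_integralD//; try exact/measurable_EFinP; last 2 first.
  - by move=> s _; rewrite lee_fin.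
  - by move=> s _; rewrite lee_fin.
  rewrite integral_exponential_pdf//.
  have -> : (\int[@lebesgue_measure R]_s (q s)%:E = \int[@lebesgue_measure R]_(s in `[0%R, 1%R]) (s `^ (b - 1))%:E)%E.
    rewrite [RHS]integral_mkcond; apply: eq_integral => s _.
    by rewrite /q !patchE; case: ifP.
  by rewrite integral_powR ?b0 ?gt_eqF// -EFinD ltry.
have ge : ((expR (-1) / b)%:E <= \int[@lebesgue_measure R]_(s in `[0%R, +oo[) (g s)%:E)%E.
  apply: (@le_trans _ _ (\int[@lebesgue_measure R]_(s in `[0%R, 1%R]) (g s)%:E)%E); last first.
    apply: ge0_subset_integral => //.
    - exact: mg.
    - by move=> s _; rewrite lee_fin.
    - exact: subset_itvl.
  apply: (@le_trans _ _ (\int[@lebesgue_measure R]_(s in `[0%R, 1%R]) ((expR (-1))%:E * (s `^ (b - 1))%:E))%E).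
    rewrite ge0_integralZl_EFin ?expR_ge0//; last 2 first.
    - by move=> s _; rewrite lee_fin powR_ge0.
    - by apply/measurable_EFinP/measurable_funTS; exact: measurable_powR.
    by rewrite integral_powR ?b0 ?gt_eqF// powR1 powR0 ?gt_eqF// subr0 -EFinM mul1r.
  apply: ge0_le_integral => //.
  - by move=> s _; rewrite mule_ge0 ?lee_fin ?expR_ge0 ?powR_ge0.
  - apply: measurable_funeM; apply/measurable_EFinP/measurable_funTS; exact: measurable_powR.
  - exact: mg.
  - move=> s; rewrite /= in_itv/= => /andP[s0 s1]; rewrite -EFinM lee_fin /g mulrC.
    by rewrite ler_wpM2l ?powR_ge0// ler_expR lerN2.
have gfin : (\int[@lebesgue_measure R]_(s in `[0%R, +oo[) (g s)%:E)%E \is a fin_num.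
  rewrite ge0_fin_numE//; apply: integral_ge0 => s _; by rewrite lee_fin.
rewrite -lte_fin fineK//; apply: lt_le_trans ge.
by rewrite lte_fin divr_gt0 ?expR_gt0.
Qed.

(** * The Caputo derivative at a weighted minimum *)

Lemma has_derivative_left_slope (R : realType) (T tau l c : R) (F : R -> R) :
  0 < tau -> tau <= T -> has_derivative_within `[0, T] F tau l -> c < l ->
  exists2 del, 0 < del & forall h, 0 < h -> h < del -> c * h <= F tau - F (tau - h).
Proof.
move=> tau0 tauT dF cl.
have lc0 : 0 < l - c by rewrite subr_gt0.
move/cvgrPdist_lt : dF => /(_ _ lc0)[/= r r0 near_tau].
exists (Num.min r tau); first by rewrite lt_min r0.
move=> h h0; rewrite lt_min => /andP[hr htau].
have := near_tau (tau - h); rewrite /= subKr ger0_norm ?(ltW h0)// => /(_ hr).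
have -> : tau - h != tau by rewrite lt_eqF// ltrBlDr ltrDl.
rewrite in_itv/= subr_ge0 (ltW htau) (le_trans _ tauT) ?gerBl ?(ltW h0)// => /(_ isT isT).
have -> : tau - h - tau = - h by ring.
rewrite invrN mulrN -mulNr opprB => /(le_lt_trans (ler_norm _)).
rewrite ltrBlDr addrC -ltrBlDr opprB addrCA subrr addr0 ltr_pdivlMr//.
exact: ltW.
Qed.

(** Shortly after a time up to which u is nonnegative, a negative weighted minimum
    makes the derivative more negative than any prescribed multiple of the
    minimum.  For alpha < 1 the weight only enters through the fact that u tau is
    also an unweighted minimum; for alpha = 1 the slope m / del of the weight is
    what forces the derivative down. *)
Lemma caputo_at_minimum (R : realType) (alpha K : R) : 0 < alpha -> alpha <= 1 -> 0 <= K ->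
  exists2 del0, 0 < del0 & forall (del T a tau m l : R) (u : R -> R),
    0 < del -> del <= del0 -> 0 <= a -> a < tau -> tau <= a + del -> tau <= T -> 0 < m ->
    {within `[0, T], continuous u} ->
    (forall s, s \in `[0, a] -> 0 <= u s) ->
    (forall s, s \in `[a, tau] -> - (m * (1 + (s - a) / del)) <= u s) ->
    u tau = - (m * (1 + (tau - a) / del)) ->
    has_caputo T alpha u tau l ->
    l < - (K * (m * (1 + (tau - a) / del))).
Proof.
move=> alpha0; rewrite le_eqVlt => /predU1P[->|alpha1] K0.
  have K1 : 0 < 2 * K + 1 by rewrite ltr_wpDl ?mulr_ge0.
  exists (2 * K + 1)^-1; first by rewrite invr_gt0.
  move=> del T a tau m l u del0 delle a0 atau taudel tauT m0 cu u0 um utau.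
  rewrite /has_caputo subrr => du.
  have tau0 : 0 < tau := le_lt_trans a0 atau.
  have delK : del * (2 * K + 1) <= 1 by rewrite -ler_pdivlMr// mul1r.
  have md : m * (2 * K) < m / del by rewrite ltr_pM2l// -[_^-1]mul1r ltr_pdivlMr//; lra.
  have le2 : K * (m * (1 + (tau - a) / del)) <= m * (2 * K).
    rewrite mulrCA ler_pM2l// mulrC ler_wpM2r//.
    have : (tau - a) / del <= 1 by rewrite ler_pdivrMr// mul1r lerBlDl.
    lra.
  suff : l <= - (m / del) by move: md le2; lra.
  rewrite leNgt; apply/negP => ml.
  have [|r r0 slope] := @has_derivative_left_slope _ T tau l ((l - m / del) / 2) _ tau0 tauT du.
    by move: ml; lra.
  (* Any admissible step contradicts the slope imposed by the weight. *)
  pose h := Num.min r (tau - a) / 2.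
  have min0 : 0 < Num.min r (tau - a) by rewrite lt_min r0 subr_gt0.
  have h0 : 0 < h by rewrite divr_gt0.
  have hmin : h < Num.min r (tau - a) by rewrite ltr_pdivrMr// ltr_pMr// ltr1n.
  move: hmin; rewrite lt_min => /andP[hr hta].
  have := slope h h0 hr; rewrite /frac_int eqxx.
  have : - (m * (1 + (tau - h - a) / del)) <= u (tau - h).
    by apply: um; rewrite in_itv/=; move: hta h0; lra.
  have -> : - (m * (1 + (tau - h - a) / del)) = u tau + m / del * h.
    by rewrite utau; field; rewrite gt_eqF.
  move=> e1 e2.
  have : (l - m / del) / 2 * h <= - (m / del) * h by move: e1 e2; lra.
  by rewrite ler_pM2r//; move: ml; lra.
pose b := 1 - alpha.
have b0 : 0 < b by rewrite subr_gt0.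
have b1 : b < 1 by rewrite gtrBl.
have G0 : 0 < Gamma b := Gamma_gt0 b0 b1.
set G := Gamma b in G0 *.
have GK1 : 0 < G * K + 1 by rewrite ltr_wpDl// mulr_ge0// ltW.
have b1E : b - 1 = - alpha by rewrite /b; ring.
(* For tau - a up to this value, (tau - a)^(- alpha) >= G K + 1 > G K. *)
exists ((G * K + 1) `^ (- alpha^-1)); first exact: powR_gt0.
move=> del T a tau m l u del0 delle a0 atau taudel tauT m0 cu u0 um utau du.
have tau0 : 0 < tau := le_lt_trans a0 atau.
have ta0 : 0 < tau - a by rewrite subr_gt0.
pose m1 := m * (1 + (tau - a) / del).
have m10 : 0 < m1 by rewrite mulr_gt0// ltr_pwDl// divr_ge0 ?(ltW ta0) ?(ltW del0).
rewrite -/m1 in utau *.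
have kerle : G * K + 1 <= (tau - a) `^ (b - 1).
  rewrite b1E powRN.
  have -> : G * K + 1 = (((G * K + 1) `^ (- alpha^-1)) `^ alpha)^-1.
    by rewrite -powRN -powRrM mulrNN mulVf ?gt_eqF// powRr1 ?(ltW GK1).
  rewrite lef_pV2 ?posrE ?powR_gt0//.
  apply: ge0_ler_powR; rewrite ?nnegrE ?powR_ge0 ?(ltW alpha0) ?(ltW ta0)//.
  by apply: le_trans delle; rewrite lerBlDl.
rewrite ltNge; apply/negP => Kl.
(* Half of the margin m1 / G between - K m1 and the bound at the minimum. *)
pose c := - (K * m1) - m1 / (2 * G).
have cl : c < l.
  apply: lt_le_trans Kl; rewrite gtrDl oppr_lt0 divr_gt0// mulr_gt0// ltr0n.
have [r r0 slope] := has_derivative_left_slope tau0 tauT du cl.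
have dcl : G * c <= - (m1 * (tau - a) `^ (b - 1)).
  pose dd := Num.min r (tau - a) / 2.
  have min0 : 0 < Num.min r (tau - a) by rewrite lt_min r0 subr_gt0.
  have dd0 : 0 < dd by rewrite divr_gt0.
  have : dd < Num.min r (tau - a) by rewrite ltr_pdivrMr// ltr_pMr// ltr1n.
  rewrite lt_min => /andP[ddr ddta].
  apply: (@frac_conv_left_slope_at_minimum _ b a tau m1 (G * c) dd u) => //.
  - exact: ltW.
  - by apply: continuous_subspaceW cu; apply: subset_itvl; rewrite bnd_simp.
  - move=> s sI; apply: le_trans (um s sI); rewrite lerN2 ler_pM2l// lerD2l.
    rewrite ler_pM2r ?invr_gt0// lerD2r.
    by move: sI; rewrite in_itv/= => /andP[].
  - move=> h h0 hdd; have := slope h h0 (le_lt_trans hdd ddr).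
    by rewrite /frac_int -/b gt_eqF// -mulrBr -/G ler_pdivlMl// mulrA.
have : G * c = - (m1 * (G * K + 1)) + m1 / 2 by rewrite /c; field; rewrite gt_eqF.
have : m1 * (G * K + 1) <= m1 * (tau - a) `^ (b - 1) by rewrite ler_pM2l.
by move: dcl m10; lra.
Qed.

(** * The coupled system *)

Lemma nonneg_mxP (R : realType) (m n : nat) (M : 'M[R]_(m, n)) :
  nonneg_mx M <-> forall i j, 0 <= M i j.
Proof.
split=> [/mxOverP M0 i j|M0]; first by have := M0 i j; rewrite nnegrE.
by apply/mxOverP => i j; rewrite nnegrE.
Qed.

Lemma within_continuous_entry (R : realType) (n : nat) (D : set R) (x : R -> 'cV[R]_n)
    (i : 'I_n) :
  {within D, continuous x} -> {within D, continuous (fun s => x s i 0)}.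
Proof.
move=> cx s; apply: (@continuous_comp (subspace D) _ _ x (fun M : 'cV[R]_n => M i 0)).
  exact: cx.
exact: coord_continuous.
Qed.

Lemma argmin_family (R : realType) (n : nat) (F : 'I_n -> R -> R) (a b : R) :
  (0 < n)%N -> a <= b -> (forall i, {within `[a, b], continuous F i}) ->
  exists i s, s \in `[a, b] /\ forall j t, t \in `[a, b] -> F i s <= F j t.
Proof.
move=> n0 ab cF.
have mins i : exists s, s \in `[a, b] /\ forall t, t \in `[a, b] -> F i s <= F i t.
  by have [s sI smin] := EVT_min ab (cF i); exists s.
have [s sP] := choice mins.
pose i0 := Ordinal n0.
case: (@arg_minP _ _ _ i0 xpredT (fun i => F i (s i)) isT) => i _ imin.
exists i, (s i); split=> [|j t tI]; first exact: (sP i).1.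
by apply: le_trans (imin j isT) _; exact: (sP j).2.
Qed.

(** The second alternative is for the diagonal entry of a Metzler matrix, whose
    sign is unknown but which multiplies the component that attains its lower
    bound. *)
Lemma sum_mul_ge (R : realType) (n : nat) (mu : R) (c z : 'I_n -> R) :
  (forall k, 0 <= c k /\ - mu <= z k \/ z k = - mu /\ 0 <= mu) ->
  - (mu * \sum_k `|c k|) <= \sum_k c k * z k.
Proof.
move=> cz; rewrite mulr_sumr -sumrN; apply: ler_sum => k _.
have [[c0 zk]|[-> mu0]] := cz k.
  by rewrite ger0_norm// mulrC -mulrN ler_wpM2l.
by rewrite mulrN lerN2 mulrC ler_wpM2l// ler_norm.
Qed.

(** A bound, valid for every row at once, for the factor by which the algebraic
    equation can amplify a lower bound on x. *)
Definition row_gain (R : realType) (n : nat) (D : 'M[R]_n) : R :=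
  \sum_j (1 - \sum_k `|D j k|)^-1.

Lemma row_gain_ge (R : realType) (n : nat) (D : 'M[R]_n) :
  (forall i : 'I_n, \sum_(j < n) `|D i j| < 1) ->
  forall j, (1 - \sum_k `|D j k|)^-1 <= row_gain D.
Proof.
move=> hDrow j; rewrite /row_gain [leRHS](bigD1 j)//= lerDl; apply: sumr_ge0 => k _.
by rewrite invr_ge0 subr_ge0 ltW.
Qed.

Lemma row_gain_ge0 (R : realType) (n : nat) (D : 'M[R]_n) :
  (forall i : 'I_n, \sum_(j < n) `|D i j| < 1) -> 0 <= row_gain D.
Proof. by move=> hDrow; apply: sumr_ge0 => k _; rewrite invr_ge0 subr_ge0 ltW. Qed.

(** At the smallest value - nu of all the components of y, the algebraic equation
    gives - nu >= - mu - nu * (row sum of D), as the rows of C sum to at most 1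
    and delayed values of y are no smaller than - nu; solve for nu. *)
Lemma algebraic_lower_bound (R : realType) (d n : nat) (r T mu tau : R)
    (C : 'M[R]_(n, d)) (D : 'M[R]_n) (tau3 : R -> R)
    (g : R -> 'cV[R]_n) (x : R -> 'cV[R]_d) (y : R -> 'cV[R]_n) :
  (0 < n)%N -> 0 < r -> is_delay r T tau3 -> nonneg_mx C -> nonneg_mx D ->
  (forall i : 'I_n, \sum_(k < d) `|C i k| < 1) ->
  (forall i : 'I_n, \sum_(j < n) `|D i j| < 1) ->
  (forall t, t \in `[0, T] -> nonneg_mx (g t)) ->
  {within `[- r, T], continuous y} ->
  (forall t, t \in `[- r, 0] -> nonneg_mx (y t)) ->
  (forall t, t \in `[0, T] -> y t = C *m x t + D *m y (t - tau3 t) + g t) ->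
  0 <= mu -> 0 <= tau -> tau <= T ->
  (forall s k, s \in `[- r, tau] -> - mu <= x s k 0) ->
  forall s j, s \in `[- r, tau] -> - (row_gain D * mu) <= y s j 0.
Proof.
move=> hn hr htau3 hC hD hCrow hDrow g0 cy yphi yE mu0 tau0 tauT xmu.
have rtau : - r <= tau by rewrite (le_trans _ tau0)// oppr_le0 ltW.
have sub : `[- r, tau] `<=` `[- r, T] by apply: subset_itvl; rewrite bnd_simp.
have [j [s [sI smin]]] := argmin_family hn rtau
  (fun j => continuous_subspaceW sub (within_continuous_entry (i := j) cy)).
move=> t k /(smin k); apply: le_trans.
have [y0|ylt0] := leP 0 (y s j 0).
  by apply: le_trans y0; rewrite oppr_le0 mulr_ge0// row_gain_ge0.
move: sI; rewrite in_itv/= => /andP[rs stau].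
(* A negative value cannot occur on the initial interval. *)
have s0 : 0 <= s.
  rewrite leNgt; apply/negP => s0; move: ylt0; rewrite ltNge => /negP; apply.
  have /nonneg_mxP : nonneg_mx (y s) by apply: yphi; rewrite in_itv/= rs ltW.
  exact.
have sT : s \in `[0, T] by rewrite in_itv/= s0 (le_trans stau).
pose nu := - y s j 0.
have nu0 : 0 < nu by rewrite oppr_gt0.
have [tau3_0 tau3_r] := htau3.2 s sT.
have cx := @sum_mul_ge R d mu (C j) (fun k => x s k 0).
have /cx{cx} : forall k, 0 <= C j k /\ - mu <= x s k 0 \/ x s k 0 = - mu /\ 0 <= mu.
  move=> l; left; split; first by move/nonneg_mxP: hC.
  by apply: xmu; rewrite in_itv/= rs.
have dy := @sum_mul_ge R n nu (D j) (fun k => y (s - tau3 s) k 0).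
have /dy{dy} : forall k, 0 <= D j k /\ - nu <= y (s - tau3 s) k 0 \/ y (s - tau3 s) k 0 = - nu /\ 0 <= nu.
  move=> l; left; split; first by move/nonneg_mxP: hD.
  rewrite opprK; apply: smin; rewrite in_itv/= tau3_r/=.
  by rewrite (le_trans _ stau)// gerBl.
have gj : 0 <= g s j 0 by move: (g0 s sT) => /nonneg_mxP.
have yj : y s j 0 = \sum_k C j k * x s k 0 + \sum_k D j k * y (s - tau3 s) k 0 + g s j 0.
  by rewrite (yE s sT) !mxE.
move=> dy cx.
have : nu * (1 - \sum_k `|D j k|) <= mu.
  have : mu * \sum_k `|C j k| <= mu by rewrite ler_piMr// ltW.
  by rewrite mulrBr mulr1 {1}/nu yj; move: dy cx gj; lra.
rewrite -ler_pdivlMr ?subr_gt0// => nule.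
rewrite -[leRHS]opprK lerN2 -/nu (le_trans nule)// mulrC ler_wpM2r//.
exact: row_gain_ge.
Qed.

(** The principle assumed for the Caputo derivatives is the conclusion of
    [caputo_at_minimum], with the constant K that bounds the i-th right-hand side
    from below when x >= - mu and y >= - row_gain D * mu. *)
Lemma positivity_step (R : realType) (d n : nat) (r T del a : R)
    (alpha : 'I_d -> R) (A B : 'M[R]_d) (E : 'M[R]_(d, n))
    (C : 'M[R]_(n, d)) (D : 'M[R]_n) (tau1 tau2 tau3 : R -> R)
    (f : R -> 'cV[R]_d) (g : R -> 'cV[R]_n) (x : R -> 'cV[R]_d) (y : R -> 'cV[R]_n) :
  (0 < d)%N -> (0 < n)%N -> 0 < r ->
  is_delay r T tau1 -> is_delay r T tau2 -> is_delay r T tau3 ->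
  metzler A -> nonneg_mx B -> nonneg_mx E -> nonneg_mx C -> nonneg_mx D ->
  (forall i : 'I_n, \sum_(k < d) `|C i k| < 1) ->
  (forall i : 'I_n, \sum_(j < n) `|D i j| < 1) ->
  (forall t, t \in `[0, T] -> nonneg_mx (f t) /\ nonneg_mx (g t)) ->
  {within `[- r, T], continuous x} -> {within `[- r, T], continuous y} ->
  (forall t, t \in `[- r, 0] -> nonneg_mx (y t)) ->
  (forall t : R, t \in `]0, T] -> forall i : 'I_d,
        has_caputo T (alpha i) (fun s => x s i 0) t
          ((A *m x t + B *m x (t - tau1 t) + E *m y (t - tau2 t) + f t) i 0)) ->
  (forall t, t \in `[0, T] -> y t = C *m x t + D *m y (t - tau3 t) + g t) ->
  0 < del -> 0 <= a ->
  (forall (i : 'I_d) (T a tau m l : R) (u : R -> R),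
    0 <= a -> a < tau -> tau <= a + del -> tau <= T -> 0 < m ->
    {within `[0, T], continuous u} ->
    (forall s, s \in `[0, a] -> 0 <= u s) ->
    (forall s, s \in `[a, tau] -> - (m * (1 + (s - a) / del)) <= u s) ->
    u tau = - (m * (1 + (tau - a) / del)) ->
    has_caputo T (alpha i) u tau l ->
    l < - ((\sum_j `|A i j| + \sum_j `|B i j| + row_gain D * \sum_j `|E i j|)
          * (m * (1 + (tau - a) / del)))) ->
  (forall s k, s \in `[- r, T] -> s <= a -> 0 <= x s k 0) ->
  forall s k, s \in `[- r, T] -> s <= a + del -> 0 <= x s k 0.
Proof.
move=> hd hn hr htau1 htau2 htau3 hA hB hE hC hD hCrow hDrow fg0 cx cy yphi dx yE
  del_gt0 a0 min_principle xa.
pose e := Num.min (a + del) T.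
have [Ta|aT] := leP T a.
  move=> s k sI _; apply: xa => //; apply: le_trans Ta.
  by move: sI; rewrite in_itv/= => /andP[].
have ae : a <= e by rewrite le_min lerDl !ltW.
have eT : e <= T by rewrite ge_min lexx orbT.
have ra : - r <= a by rewrite (le_trans _ a0)// oppr_le0 ltW.
have r0 : - r <= 0 by rewrite oppr_le0 ltW.
(* The weight of the minimum; it is 1 at a and at most 2 on the step. *)
pose q s := 1 + (s - a) / del.
have q_gt0 s : a <= s -> 0 < q s.
  by move=> as_; rewrite ltr_pwDl// divr_ge0 ?subr_ge0// ltW.
have cxq i : {within `[a, e], continuous (fun s => x s i 0 / q s)}.
  have cxi : {within `[a, e], continuous (fun s => x s i 0)}.
    apply: continuous_subspaceW (within_continuous_entry (i := i) cx).
    move=> s /=; rewrite !in_itv/= => /andP[as_ se].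
    by rewrite (le_trans ra as_) (le_trans se eT).
  have cq : {within `[a, e], continuous (fun s => (q s)^-1)}.
    apply: continuous_in_subspaceT => s; rewrite inE/= in_itv/= => /andP[as_ _].
    apply: continuousV; first by rewrite gt_eqF// q_gt0.
    apply: cvgD; first exact: cvg_cst.
    apply: cvgMl; apply: cvgB; [exact: cvg_id|exact: cvg_cst].
  by move=> s; apply: cvgM; [exact: cxi|exact: cq].
have [i [tau [tauI tau_min]]] := argmin_family hd ae cxq.
set v := x tau i 0 / q tau in tau_min.
have xge s k : s \in `[a, e] -> v * q s <= x s k 0.
  move=> sI; rewrite -ler_pdivlMr; first exact: tau_min.
  by apply: q_gt0; move: sI; rewrite in_itv/= => /andP[].
suff v0 : 0 <= v.
  move=> s k sI sa; have [|as_] := leP s a; first exact: xa.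
  have sI' : s \in `[a, e].
    rewrite in_itv/= ltW//= le_min sa/=.
    by move: sI; rewrite in_itv/= => /andP[].
  by apply: le_trans (xge s k sI'); rewrite mulr_ge0// ltW// q_gt0// ltW.
rewrite leNgt; apply/negP => v_lt0.
pose m := - v.
have m0 : 0 < m by rewrite oppr_gt0.
move: (tauI); rewrite in_itv/= => /andP[atau taue].
have qtau := q_gt0 tau atau.
have xtau : x tau i 0 = - (m * q tau).
  by rewrite /m mulNr opprK /v divfK// gt_eqF.
have a_lt_tau : a < tau.
  rewrite lt_neqAle atau andbT; apply/eqP => a_eq.
  have : 0 <= x tau i 0.
    by apply: xa; rewrite -a_eq// in_itv/= ra ltW.
  by rewrite xtau oppr_ge0 leNgt mulr_gt0.
have tauT : tau <= T := le_trans taue eT.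
have tau0 : 0 < tau := le_lt_trans a0 a_lt_tau.
have tauIT : tau \in `[0, T] by rewrite in_itv/= ltW.
pose mu := m * q tau.
have mu0 : 0 < mu by rewrite mulr_gt0.
have xmu s k : s \in `[- r, tau] -> - mu <= x s k 0.
  rewrite in_itv/= => /andP[rs stau]; have [sa|as_] := leP s a.
    have : 0 <= x s k 0 by apply: xa; rewrite ?in_itv/= ?rs ?(le_trans stau tauT) ?sa.
    by apply: le_trans; rewrite oppr_le0 ltW.
  have sI : s \in `[a, e] by rewrite in_itv/= (ltW as_) (le_trans stau).
  apply: le_trans (xge s k sI); rewrite -[v]opprK -/m mulNr lerN2 /mu ler_pM2l//.
  by rewrite lerD2l ler_pM2r ?invr_gt0// lerD2r.
have ymu := algebraic_lower_bound hn hr htau3 hC hD hCrow hDrow (fun t tI => (fg0 t tI).2)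
  cy yphi yE (ltW mu0) (ltW tau0) tauT xmu.
have [tau1_0 tau1_r] := htau1.2 tau tauIT.
have [tau2_0 tau2_r] := htau2.2 tau tauIT.
have dtau := dx tau _ i; rewrite in_itv/= tau0 tauT in dtau.
have /negP : ~~ (- ((\sum_j `|A i j| + \sum_j `|B i j| + row_gain D * \sum_j `|E i j|) * mu)
    <= (A *m x tau + B *m x (tau - tau1 tau) + E *m y (tau - tau2 tau) + f tau) i 0).
  rewrite -ltNge; apply: (min_principle i T a tau m _ (fun s => x s i 0)) (dtau isT) => //.
  - by apply: le_trans taue _; rewrite ge_min lexx.
  - apply: continuous_subspaceW (within_continuous_entry (i := i) cx).
    by apply: subset_itvr; rewrite bnd_simp.
  - move=> s; rewrite in_itv/= => /andP[s0 sa]; apply: xa => //.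
    by rewrite in_itv/= (le_trans r0 s0) (le_trans sa (ltW aT)).
  - move=> s; rewrite in_itv/= => /andP[as_ stau].
    rewrite -mulNr /m opprK; apply: xge; rewrite in_itv/= as_/=.
    exact: le_trans stau taue.
apply.
(* Each term of the right-hand side at tau is bounded below in terms of mu. *)
have Ax : - (mu * \sum_k `|A i k|) <= \sum_k A i k * x tau k 0.
  apply: sum_mul_ge => k; have [->|ik] := eqVneq k i.
    by right; rewrite ltW.
  left; split; first by apply: hA; rewrite eq_sym.
  by apply: xmu; rewrite in_itv/= lexx (le_trans r0 (ltW tau0)).
have Bx : - (mu * \sum_k `|B i k|) <= \sum_k B i k * x (tau - tau1 tau) k 0.
  apply: sum_mul_ge => k; left; split; first by move/nonneg_mxP: hB.
  by apply: xmu; rewrite in_itv/= tau1_r gerBl.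
have Ey : - (row_gain D * mu * \sum_k `|E i k|) <= \sum_k E i k * y (tau - tau2 tau) k 0.
  apply: sum_mul_ge => k; left; split; first by move/nonneg_mxP: hE.
  by apply: ymu; rewrite in_itv/= tau2_r gerBl.
have f0 : 0 <= f tau i 0 by move: (fg0 tau tauIT).1 => /nonneg_mxP.
have -> : (A *m x tau + B *m x (tau - tau1 tau) + E *m y (tau - tau2 tau) + f tau) i 0 =
  \sum_k A i k * x tau k 0 + \sum_k B i k * x (tau - tau1 tau) k 0 +
  \sum_k E i k * y (tau - tau2 tau) k 0 + f tau i 0 by rewrite !mxE.
rewrite -[leLHS]addr0; apply: lerD => //.
rewrite mulrC !mulrDr mulrA [mu * row_gain D]mulrC !opprD.
by rewrite !lerD.
Qed.

Unset Implicit Arguments.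

Theorem theorem4p2 (R : realType) (d n : nat) (r T : R)
    (alpha : 'I_d -> R) (A B : 'M[R]_d) (E : 'M[R]_(d, n))
    (C : 'M[R]_(n, d)) (D : 'M[R]_n) (tau1 tau2 tau3 : R -> R)
    (hd : (0 < d)%N) (hn : (0 < n)%N) (hr : 0 < r) (hT : 0 < T)
    (halpha : forall i, 0 < alpha i /\ alpha i <= 1)
    (htau1 : is_delay r T tau1)
    (htau2 : is_delay r T tau2)
    (htau3 : is_delay r T tau3)
    (hA : metzler A) (hB : nonneg_mx B) (hE : nonneg_mx E)
    (hC : nonneg_mx C) (hD : nonneg_mx D)
    (hCrow : forall i : 'I_n, \sum_(k < d) `|C i k| < 1)
    (hDrow : forall i : 'I_n, \sum_(j < n) `|D i j| < 1) :
  positive_system r T alpha A B E C D tau1 tau2 tau3.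
Proof.
move=> f g psi phi _ _ _ _ fg0 psiphi0 _ x y [cx cy init dx yE].
have yphi t : t \in `[- r, 0] -> nonneg_mx (y t).
  by move=> tI; rewrite (init t tI).2; exact: (psiphi0 t tI).2.
pose K i := \sum_j `|A i j| + \sum_j `|B i j| + row_gain D * \sum_j `|E i j|.
have K0 i : 0 <= K i.
  by rewrite !addr_ge0 ?mulr_ge0 ?row_gain_ge0//; apply: sumr_ge0.
have /choice[del0 del0P] : forall i, exists del0, 0 < del0 /\ forall (del T a tau m l : R) (u : R -> R),
    0 < del -> del <= del0 -> 0 <= a -> a < tau -> tau <= a + del -> tau <= T -> 0 < m ->
    {within `[0, T], continuous u} ->
    (forall s, s \in `[0, a] -> 0 <= u s) ->
    (forall s, s \in `[a, tau] -> - (m * (1 + (s - a) / del)) <= u s) ->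
    u tau = - (m * (1 + (tau - a) / del)) ->
    has_caputo T (alpha i) u tau l ->
    l < - (K i * (m * (1 + (tau - a) / del))).
  move=> i; have [a0 a1] := halpha i.
  by have [del0 del0_gt0 H] := caputo_at_minimum a0 a1 (K0 i); exists del0.
pose del := \big[Num.min/1]_i del0 i.
have del_gt0 : 0 < del by apply/bigmin_gtP; split=> [|i _]; [exact: ltr01|exact: (del0P i).1].
have del_le i : del <= del0 i by exact: bigmin_le_cond.
have step a : 0 <= a -> (forall s k, s \in `[- r, T] -> s <= a -> 0 <= x s k 0) ->
    forall s k, s \in `[- r, T] -> s <= a + del -> 0 <= x s k 0.
  move=> a0; apply: (@positivity_step _ _ _ r T del a alpha A B E C D tau1 tau2 tau3 f g x y) => //.
  by move=> i T' a' tau m l u; apply: (del0P i).2.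
have steps (N : nat) : forall s k, s \in `[- r, T] -> s <= del *+ N -> 0 <= x s k 0.
  elim: N => [s k|N IH]; last by rewrite mulrSr; apply: step => //; rewrite mulrn_wge0// ltW.
  rewrite mulr0n in_itv/= => /andP[rs _] s0.
  have sI : s \in `[- r, 0] by rewrite in_itv/= rs.
  by rewrite (init s sI).1; move: (psiphi0 s sI).1 => /nonneg_mxP.
have x0 s k : s \in `[- r, T] -> 0 <= x s k 0.
  move=> sI; apply: (steps (Num.bound (T / del))) => //.
  move: sI; rewrite in_itv/= => /andP[_ /le_trans]; apply.
  rewrite -mulr_natl -ler_pdivrMr// ltW// archi_boundP// divr_ge0// ltW//.
have r0 : - r <= 0 by rewrite oppr_le0 ltW.
have y0 := algebraic_lower_bound hn hr htau3 hC hD hCrow hDrow (fun t tI => (fg0 t tI).2)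
  cy yphi yE (lexx 0) (ltW hT) (lexx T).
move=> t; rewrite in_itv/= => /andP[t0 tT].
have tI : t \in `[- r, T] by rewrite in_itv/= tT (le_trans r0).
split; apply/nonneg_mxP => k j; rewrite ord1; first exact: x0.
rewrite -oppr0 -[X in - X](mulr0 (row_gain D)); apply: y0 => // s l sI.
by rewrite oppr0; exact: x0.
Qed.
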